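(* Let $n\ge 2$ and let $(\mathscr F,\mathcal C)$ be an admissible pair on the annulus $\mathcal A_{0,\infty}=\mathbb C^n\setminus\{0\}$, where $\mathscr F(\mathbf z)$ is a smooth function on $\mathbb C^n$ whose first nonzero term in the Taylor expansion (in $\mathbf z$) about the origin is of order $k$. Consider the uniquely associated $\mathrm{U}(n)$-invariant non-Kähler Hermitian Klsc metric $$g_{(\mathscr F,\mathcal C)}=\Bigg((\mathbf z\mathscr F)'-\frac{2}{\mathbf z^{n-1}\mathscr F^{n-2}}\Big(\int\frac{1}{\mathbf z^n\mathscr F^{n-1}}\,d\mathbf z+(2n-1)\,\mathcal C\Big)^{-1}\Bigg)\Big((d\sqrt{\mathbf z})^2+\mathbf z\, h\Big)+(\mathbf z\mathscr F)\, g_{\mathbb{CP}^{n-1}}.$$ (1) The metric $g_{(\mathscr F,\mathcal C)}$ extends to $(\mathbb C^n,J_0)$ with a canonical asymptotically cone-like singularity at the origin, in the sense that there exists a change of the radial variable $r=r(\mathbf z)$ so that near the origin the metric is given by $$g_{(\mathscr F,\mathcal C)}=dr^2+\Big(\frac{k+1}{2n-1}\Big)r^2\Big(g_{\mathbb{CP}^{n-1}}+(k+1)(2n-1)h\Big)+h.o.t.$$ (2) The class of this extension over the origin is described as follows: - when $k=0$ or $k=1$, the metric is precisely of class $C^\infty$ if $\frac{\partial^{(k+1)(n-1)}}{\partial\mathbf z^{(k+1)(n-1)}}\big(\frac{\mathbf z^k}{\mathscr F}\big)^{n-1}\big|_{\mathbf z=0}=0$, and precisely of class $C^{2n-3}$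 otherwise; - when $k\ge2$, the metric is, a priori, of class $C^0$ (that is, at least of class $C^0$; possibly of higher class).
   Context: $J_0$ is the standard complex structure on $\mathbb C^n$, $\mathbf z=\sum_{i=1}^n|z_i|^2$, and primes denote derivatives with respect to $\mathbf z$. The round metric on the unit sphere $S^{2n-1}$ decomposes as $g_{S^{2n-1}}=g_{\mathbb{CP}^{n-1}}+h$, where $g_{\mathbb{CP}^{n-1}}$ is (the pullback under the Hopf fibration of) the Fubini–Study metric on $\mathbb{CP}^{n-1}$ and $h$ is the metric along the Hopf fiber. Admissibility: let $\mathscr F(\mathbf z)$ be a smooth positive function on $\mathcal A_{0,\infty}=\mathbb C^n\setminus\{0\}$, with a fixed antiderivative $\int\frac{1}{\mathbf z^n\mathscr F^{n-1}}d\mathbf z$ (the same one is used in every formula), and $\mathcal C$ a real constant. The pair $(\mathscr F,\mathcal C)$ is admissible if $$\mathbf z\mathscr F\cdot\Big(\frac{1}{2n-1}\int\frac{1}{\mathbf z^n\mathscr F^{n-1}}\,d\mathbf z+\mathcal C\Big)^{-2}$$ is defined and strictly increasing there, in the sense that its $\mathbf z$-derivative is everywhere positive. Klsc: a Hermitian metric is a Kähler like scalar curvature (Klsc) metric if $S=2S_C$, where $S$ is the Riemannian scalar curvature (Levi-Civita connection) and $S_C=g^{i\bar j}\Theta_{i\bar j}$, with $\sqrt{-1}\,\Theta_{i\bar j}\,dz_i\wedge d\bar z_j=-\sqrt{-1}\,\partial\bar\partial\log\det(g_{i\bar j})$, is the Chern scalar curvature. For an admissible pair, $g_{(\mathscr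 F,\mathcal C)}$ is a $\mathrm{U}(n)$-invariant non-Kähler Hermitian Klsc metric on $(\mathbb C^n\setminus\{0\},J_0)$. ''$h.o.t.$'' (higher order terms) denotes an expression $a(r)\,dr^2+b(r)\,h+c(r)\,g_{\mathbb{CP}^{n-1}}$ whose coefficients vanish faster at the origin than the corresponding model terms: $a(r)=o(1)$, $b(r)=o(r^2)$, $c(r)=o(r^2)$ as $r\to0^+$. The metric (its extension) is said to be of class $C^\ell$ over the origin, where $C^\ell$ is the lowest regularity that any of the coefficients $a,b,c$ of the higher order terms has, as a function of the variable $r$, over (i.e. up to and including) $r=0$. The function $\mathbf z^k/\mathscr F$ is extended smoothly to $\mathbf z=0$. *)

(* Defs.v *)
(* MathComp-Analysis, over an arbitrary [R : realType]. *)
From mathcomp Require Import all_boot all_order all_algebra.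
From mathcomp Require Import all_classical all_reals all_analysis.
Set Implicit Arguments.
Unset Strict Implicit.
Unset Printing Implicit Defensive.
Import Order.TTheory GRing.Theory Num.Theory.
Import numFieldNormedType.Exports.
Local Open Scope classical_set_scope.
Local Open Scope ring_scope.

(* C^n as a real normed space: (x, y) stands for the vector x + i y, and a
   tangent vector at any point is again a pair. *)
Notation Cspace R n := ('rV[R]_n * 'rV[R]_n)%type.

Section OneSidedCalculus.
Context {R : realType}.
Implicit Types (D : set R) (f : R -> R).

(* Derivatives are taken through increments that stay in D; on an interval they
   are therefore one-sided at the endpoints belonging to D, and the values of f
   outside D play no role. *)
Definition diff_quot f (x y : R) : R := (f y - f x) / (y - x).

Definition derivable_in D f (x : R) : Prop :=
  cvg (diff_quot f x y @[y --> within D x^']).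

Definition derive_in D f : R -> R :=
  fun x => lim (diff_quot f x y @[y --> within D x^']).

Definition deriven_in D (m : nat) f : R -> R := iter m (derive_in D) f.

Definition Ck_in D (l : nat) f : Prop :=
  (forall j : nat, (j < l)%N -> forall x, D x -> derivable_in D (deriven_in D j f) x)
  /\ {within D, continuous (deriven_in D l f)}.

Definition smooth_in D f : Prop := forall l : nat, Ck_in D l f.

(* The first nonzero term of the Taylor expansion of f at the origin, in the
   variable ranging over [0, +oo[, has order k. *)
Definition taylor_order f (k : nat) : Prop :=
  (forall j : nat, (j < k)%N -> deriven_in `[0, +oo[ j f 0 = 0)
  /\ deriven_in `[0, +oo[ k f 0 != 0.

(* Regularity up to and including r = 0 of functions of r. *)
Definition Ck_over0 (l : nat) f : Prop :=
  exists2 e : R, 0 < e & Ck_in `[0, e[ l f.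

Definition smooth_over0 f : Prop :=
  exists2 e : R, 0 < e & smooth_in `[0, e[ f.

(* Lowest regularity of the three coefficients a, b, c. *)
Definition coeffs_Ck (l : nat) (a b c : R -> R) : Prop :=
  [/\ Ck_over0 l a, Ck_over0 l b & Ck_over0 l c].

Definition coeffs_smooth (a b c : R -> R) : Prop :=
  [/\ smooth_over0 a, smooth_over0 b & smooth_over0 c].

Definition coeffs_precisely_Ck (l : nat) (a b c : R -> R) : Prop :=
  coeffs_Ck l a b c /\ ~ coeffs_Ck l.+1 a b c.

End OneSidedCalculus.

(* All iterated directional derivatives of f exist and are differentiable at
   every point of U; for U open this is smoothness on U. *)
Definition smooth_map {R : realType} {V : normedModType R} (U : set V)
    (f : V -> R) : Prop :=
  forall (vs : seq V) (p : V), U p ->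
    differentiable (foldr (fun v (g : V -> R) => 'D_v g) f vs) p.

Section UnitaryGeometry.
Context {R : realType} {n : nat}.
Implicit Types (p v w : Cspace R n).

Definition dotC v w : R :=
  \sum_(i < n) v.1 ord0 i * w.1 ord0 i + \sum_(i < n) v.2 ord0 i * w.2 ord0 i.

Definition J0 v : Cspace R n := (- v.2, v.1).

Definition normsq p : R := dotC p p.

(* A symmetric 2-tensor field, evaluated at a point on two tangent vectors. *)
Definition tensor2 := Cspace R n -> Cspace R n -> Cspace R n -> R.

(* The square (d f)^2 of the differential of a function f. *)
Definition dsq (f : Cspace R n -> R) : tensor2 :=
  fun p v w => 'D_v f p * 'D_w f p.

(* Pullback by p |-> p / |p| of the part of the round metric of S^(2n-1) along
   the Hopf fibers, whose unit tangent at a point q of the sphere is J0 q. *)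
Definition hopf_metric : tensor2 :=
  fun p v w => dotC v (J0 p) * dotC w (J0 p) / normsq p ^+ 2.

(* Pullback by p |-> [p] of the Fubini-Study metric: the real part of
   (|p|^2 <v, w> - <v, p> <p, w>) / |p|^4, where <v, w> is the Hermitian product,
   with real part dotC v w and imaginary part dotC v (J0 w).  The sum of
   FS_metric and hopf_metric is the pullback of the round metric. *)
Definition FS_metric : tensor2 :=
  fun p v w =>
    (normsq p * dotC v w
     - (dotC v p * dotC w p + dotC v (J0 p) * dotC w (J0 p))) / normsq p ^+ 2.

End UnitaryGeometry.

(* Throughout, z is the value of normsq, F the profile function, I the chosen
   antiderivative of 1 / (z^n F^(n-1)) and C the real constant. *)
Definition is_antiderivative {R : realType} (n : nat) (F I : R -> R) : Prop :=
  forall z : R, 0 < z -> is_derive z 1 I (1 / (z ^+ n * F z ^+ n.-1)).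

Definition admissible_fun {R : realType} (n : nat) (I : R -> R) (C : R)
    (F : R -> R) : R -> R :=
  fun z => z * F z * ((1 / (2 * n - 1)%:R * I z + C) ^+ 2)^-1.

Definition admissible {R : realType} (n : nat) (F I : R -> R) (C : R) : Prop :=
  [/\ smooth_map [set p : Cspace R n | p != 0] (F \o normsq),
      forall z : R, 0 < z -> 0 < F z,
      is_antiderivative n F I,
      forall z : R, 0 < z -> 1 / (2 * n - 1)%:R * I z + C != 0
    & forall z : R, 0 < z -> 0 < derive1 (admissible_fun n I C F) z].

Definition klsc_coef {R : realType} (n : nat) (F I : R -> R) (C z : R) : R :=
  derive1 (fun t => t * F t) z
  - 2 / (z ^+ n.-1 * F z ^+ n.-2) * (I z + (2 * n - 1)%:R * C)^-1.

(* The metric g_(F, C) on C^n \ {0}. *)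
Definition klsc_metric {R : realType} (n : nat) (F I : R -> R) (C : R) :
    @tensor2 R n :=
  fun p v w =>
    let z := normsq p in
    klsc_coef n F I C z
      * (dsq (fun q => Num.sqrt (normsq q)) p v w + z * hopf_metric p v w)
    + z * F z * FS_metric p v w.

(* z^k / F, extended to z = 0 by its limit. *)
Definition pow_quot {R : realType} (k : nat) (F : R -> R) : R -> R :=
  fun z => if z == 0 then lim (t ^+ k / F t @[t --> 0^'+]) else z ^+ k / F z.

(* dr^2 + (k+1)/(2n-1) r^2 (g_CP + (k+1)(2n-1) h), with r a function of z. *)
Definition cone_metric {R : realType} (n k : nat) (r : R -> R) : @tensor2 R n :=
  fun p v w =>
    dsq (r \o normsq) p v w
    + k.+1%:R / (2 * n - 1)%:R * r (normsq p) ^+ 2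
      * (FS_metric p v w + k.+1%:R * (2 * n - 1)%:R * hopf_metric p v w).

(* a(r) dr^2 + b(r) h + c(r) g_CP. *)
Definition polar_tensor {R : realType} (n : nat) (r a b c : R -> R) :
    @tensor2 R n :=
  fun p v w =>
    a (r (normsq p)) * dsq (r \o normsq) p v w
    + b (r (normsq p)) * hopf_metric p v w
    + c (r (normsq p)) * FS_metric p v w.

Definition higher_order_coeffs {R : realType} (a b c : R -> R) : Prop :=
  [/\ a x @[x --> 0^'+] --> (0 : R),
      b x / x ^+ 2 @[x --> 0^'+] --> (0 : R)
    & c x / x ^+ 2 @[x --> 0^'+] --> (0 : R)].

(* A new radial variable r = r(z) on 0 < z < d, tending to 0 at the origin and
   equal to z^((k+1)/2) up to a factor that is smooth and positive up to z = 0.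
   The last requirement fixes the smooth structure in which regularity over r = 0
   is measured: when a logarithm occurs, the arc length parameter would make a
   vanish and raise the regularity of b and c. *)
Definition radial_change {R : realType} (k : nat) (d : R) (r : R -> R) : Prop :=
  [/\ smooth_in `]0, d[ r,
      forall z : R, 0 < z < d -> 0 < derive1 r z,
      r z @[z --> 0^'+] --> (0 : R)
    & exists u : R -> R,
        [/\ smooth_in `[0, d[ u,
            forall z : R, 0 <= z < d -> 0 < u z
          & forall z : R, 0 < z < d -> r z ^+ 2 = z ^+ k.+1 * u z]].

(* Main.v *)
Require Import Defs.
From mathcomp Require Import all_boot all_order all_algebra.
From mathcomp Require Import all_classical all_reals all_analysis.
From mathcomp Require Import ring lra.
Import Order.TTheory GRing.Theory Num.Theory.
Import numFieldNormedType.Exports.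
Local Open Scope classical_set_scope.
Local Open Scope ring_scope.

(** Write n = p + 2, N = (k+1)(n-1), and F = z^k G with G smooth and positive on
    [0, +oo[.  Put H = G^(1-n), which is (z^k / F)^(n-1).  The antiderivative in
    the metric has derivative H / z^(N+1), so that termwise integration of the
    Taylor expansion of H gives
      E := z^N (I + (2n-1) C) = P + h z^N ln z,
    with P smooth, P(0) = - H(0) / N and h = H^(N)(0) / N! ([antideriv_log]).
    The only obstruction to smoothness is thus the Taylor coefficient of H of
    order N.  The coefficient of the metric is z^k B(z), where
      B = (k+1) G + z G' - 2 G^(2-n) / E,   B(0) = (k+1)(2n-1) G(0)
    ([klsc_coefE], [coef0E]).

    Take r = s z^((k+1)/2) with s^2 = (2n-1) G(0) / (k+1).  Freezing B and G at
    z = 0 turns the metric into the model cone, and what remains has coefficients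
      a = B / B(0) - 1,   b = z^(k+1) (B - B(0)),   c = z^(k+1) (G - G(0)),
    as functions of r.  Since B and G are continuous in z = (r/s)^(2/(k+1)), these
    are of higher order and continuous, for every k ([cone_higher_order]).
    If k <= 1, then z = (r/s)^q with q = 2/(k+1) an integer, so that smooth
    functions of z are smooth functions of r, and N q = 2n-2: the logarithmic term
    of E is a multiple of r^(2n-2) ln r up to a monomial ([E_radial_inv_log]).
    This function is C^(2n-3) up to r = 0 ([CK_powln]) but not C^(2n-2)
    ([powln_not_CK]); and since E is a rational function of a and of smooth
    functions, a inherits the defect ([cone_a_not_CK]).

    Two facts of calculus on [0, +oo[ make this rigorous: Hadamard's lemma, that
    f(x) = f(0) + x K(x) with K as smooth as f', and Whitney's theorem, that a
    smooth even function of t is a smooth function of t^2, by which F is smooth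
    up to z = 0 ([hadamard], [CK_even_sqrt], [radial_Cinf]). *)

(** * Differentiation relative to a subset of the line *)

Section Calculus.
Set Implicit Arguments.
Unset Strict Implicit.
Context {R : realType}.
Implicit Types (D : set R) (f g q : R -> R) (l : nat).

Definition cont_in D f := forall x, D x -> f y @[y --> within D (nbhs x)] --> f x.

(** Caratheodory's form of the derivative: the slope [q] is a continuous factor
    instead of a quotient, so that the product and chain rules become identities
    free of the quotient by [g y - g x], which may vanish. *)
Definition has_deriv D f g := forall x, D x -> exists q,
  [/\ forall y, D y -> f y - f x = q y * (y - x), q x = g x
    & q y @[y --> within D (nbhs x)] --> q x].

(** C^l regularity with the successive derivatives existentially quantified, which
    makes closure under sums, products, inverses and composition a direct
    induction on [l]. *)
Fixpoint CK D l f : Prop :=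
  if l is l'.+1 then exists2 g, has_deriv D f g & CK D l' g else cont_in D f.

Definition Cinf D f := forall l, CK D l f.

Lemma within_cvg_eq D (F : set_system R) (FF : Filter F) f g (a : R) :
  (forall y, D y -> f y = g y) -> g @ within D F --> a -> f @ within D F --> a.
Proof.
move=> fg; apply: cvg_trans; apply: near_eq_cvg.
by rewrite /within /prop_near1 nbhs_simpl /=; apply: filterE => y /fg.
Qed.

Lemma cont_ext D f g : (forall x, D x -> f x = g x) -> cont_in D g -> cont_in D f.
Proof. by move=> fg cg x Dx; rewrite (fg x Dx); apply: within_cvg_eq fg (cg x Dx). Qed.

Lemma has_deriv_ext D f g f' g' : (forall x, D x -> f x = f' x) ->
  (forall x, D x -> g x = g' x) -> has_deriv D f' g' -> has_deriv D f g.
Proof.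
move=> ff gg h x Dx; have [q [q1 q2 q3]] := h x Dx.
by exists q; split => // [y Dy|]; rewrite ?ff ?gg //; apply: q1.
Qed.

Lemma CK_ext D l f g : (forall x, D x -> f x = g x) -> CK D l g -> CK D l f.
Proof.
case: l => [|l] fg /=; first exact: cont_ext.
by case=> g' h c; exists g' => //; apply: has_deriv_ext h.
Qed.

Lemma cont_sub D D' f : D' `<=` D -> cont_in D f -> cont_in D' f.
Proof.
move=> s c x Dx; apply: cvg_trans (c x (s _ Dx)).
by apply: cvg_app; apply: within_subset.
Qed.

Lemma has_deriv_sub D D' f g : D' `<=` D -> has_deriv D f g -> has_deriv D' f g.
Proof.
move=> s h x Dx; have [q [q1 q2 q3]] := h x (s _ Dx).
exists q; split => // [y Dy|]; first exact/q1/s.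
by apply: cvg_trans q3; apply: cvg_app; apply: within_subset.
Qed.

Lemma CK_sub D D' l f : D' `<=` D -> CK D l f -> CK D' l f.
Proof.
move=> s; elim: l f => [|l IH] f /=; first exact: cont_sub.
by case=> g h c; exists g; [apply: has_deriv_sub h|apply: IH].
Qed.

Lemma has_deriv_cont D f g : has_deriv D f g -> cont_in D f.
Proof.
move=> h x Dx; have [q [q1 q2 q3]] := h x Dx.
apply: (@within_cvg_eq _ _ _ _ (fun y => f x + q y * (y - x))).
  by move=> y Dy; rewrite -q1 // addrC subrK.
rewrite -[X in _ --> X]addr0 -(mulr0 (q x)) -(subrr x).
apply: cvgD; first exact: cvg_cst.
by apply: cvgM => //; apply: cvgB; [apply: cvg_within|apply: cvg_cst].
Qed.

Lemma CK_cont D l f : CK D l f -> cont_in D f.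
Proof. by case: l => //= l [g h _]; apply: has_deriv_cont h. Qed.

Lemma CKS D l f : CK D l.+1 f -> CK D l f.
Proof.
elim: l f => [|l IH] f; first exact: CK_cont.
by case=> g h c; exists g => //; apply: IH.
Qed.

Lemma CK_le D l m f : (m <= l)%N -> CK D l f -> CK D m f.
Proof.
move=> /subnK <-; elim: (_ - _)%N => // j IH.
by rewrite addSn => /CKS.
Qed.

Lemma has_deriv_cst D (a : R) : has_deriv D (fun=> a) (fun=> 0).
Proof.
move=> x Dx; exists (fun=> 0); split => // [y _|]; last exact: cvg_cst.
by rewrite subrr mul0r.
Qed.

Lemma has_deriv_id D : has_deriv D id (fun=> 1).
Proof.
move=> x Dx; exists (fun=> 1); split => // [y _|]; last exact: cvg_cst.
by rewrite mul1r.
Qed.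

Lemma has_derivD D f g f' g' : has_deriv D f f' -> has_deriv D g g' ->
  has_deriv D (fun x => f x + g x) (fun x => f' x + g' x).
Proof.
move=> hf hg x Dx; have [q [q1 q2 q3]] := hf x Dx; have [u [u1 u2 u3]] := hg x Dx.
exists (fun y => q y + u y); split=> [y Dy||]; last exact: cvgD.
  by rewrite mulrDl -q1 // -u1 //; ring.
by rewrite q2 u2.
Qed.

Lemma has_derivM D f g f' g' : has_deriv D f f' -> has_deriv D g g' ->
  has_deriv D (fun x => f x * g x) (fun x => f' x * g x + f x * g' x).
Proof.
move=> hf hg x Dx; have [q [q1 q2 q3]] := hf x Dx; have [u [u1 u2 u3]] := hg x Dx.
exists (fun y => q y * g y + f x * u y); split=> [y Dy||].
- transitivity ((f y - f x) * g y + f x * (g y - g x)); first by ring.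
  by rewrite q1 // u1 //; ring.
- by rewrite q2 u2.
- apply: cvgD; apply: cvgM => //; last exact: cvg_cst.
  exact: (has_deriv_cont hg).
Qed.

Lemma has_deriv_comp D D' f g f' g' : (forall x, D x -> D' (g x)) ->
  has_deriv D' f f' -> has_deriv D g g' ->
  has_deriv D (fun x => f (g x)) (fun x => f' (g x) * g' x).
Proof.
move=> DD hf hg x Dx; have [q [q1 q2 q3]] := hf _ (DD x Dx).
have [u [u1 u2 u3]] := hg x Dx.
exists (fun y => q (g y) * u y); split=> [y Dy||].
- by rewrite q1 ?u1 ?mulrA //; apply: DD.
- by rewrite q2 u2.
- apply: cvgM => //; apply: cvg_comp q3.
  move=> A; rewrite /within /= => wA.
  have /= := has_deriv_cont hg Dx wA.
  rewrite !nbhs_simpl /= /within /=; apply: filterS => y AA Dy.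
  by apply: AA => //; apply: DD.
Qed.

Lemma has_derivV D f f' : (forall x, D x -> f x != 0) -> has_deriv D f f' ->
  has_deriv D (fun x => (f x)^-1) (fun x => - f' x * ((f x)^-1 * (f x)^-1)).
Proof.
move=> f0 hf x Dx; have [q [q1 q2 q3]] := hf x Dx.
exists (fun y => - q y * ((f y)^-1 * (f x)^-1)); split=> [y Dy||].
- have -> : - q y * ((f y)^-1 * (f x)^-1) * (y - x) =
            - (q y * (y - x)) * ((f y)^-1 * (f x)^-1) by ring.
  by rewrite -q1 //; field; rewrite !f0.
- by rewrite q2.
- apply: cvgM; first exact: cvgN.
  apply: cvgM; last exact: cvg_cst.
  by apply: cvgV; [apply: f0|apply: (has_deriv_cont hf)].
Qed.

Lemma CK_cst D l (a : R) : CK D l (fun=> a).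
Proof.
elim: l a => [|l IH] a /=; first by move=> x _; apply: cvg_cst.
by exists (fun=> 0); [apply: has_deriv_cst|apply: IH].
Qed.

Lemma CK_id D l : CK D l id.
Proof.
case: l => [|l] /=; first by move=> x _; apply: cvg_within.
by exists (fun=> 1); [apply: has_deriv_id|apply: CK_cst].
Qed.

Lemma CKD D l f g : CK D l f -> CK D l g -> CK D l (fun x => f x + g x).
Proof.
elim: l f g => [|l IH] f g /=.
  by move=> cf cg x Dx; apply: cvgD; [apply: cf|apply: cg].
move=> [f' hf cf] [g' hg cg]; exists (fun x => f' x + g' x).
  exact: has_derivD.
exact: IH.
Qed.

Lemma CKM D l f g : CK D l f -> CK D l g -> CK D l (fun x => f x * g x).
Proof.
elim: l f g => [|l IH] f g.
  by move=> cf cg x Dx; apply: cvgM; [apply: cf|apply: cg].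
move=> Cf Cg; have [f' hf cf] := Cf; have [g' hg cg] := Cg.
exists (fun x => f' x * g x + f x * g' x); first exact: has_derivM.
by apply: CKD; apply: IH => //; apply: CKS.
Qed.

Lemma CKN D l f : CK D l f -> CK D l (fun x => - f x).
Proof.
move=> cf; apply: (@CK_ext _ _ _ (fun x => -1 * f x)).
  by move=> x _; rewrite mulN1r.
by apply: CKM => //; apply: CK_cst.
Qed.

Lemma CKB D l f g : CK D l f -> CK D l g -> CK D l (fun x => f x - g x).
Proof. by move=> cf cg; apply: CKD => //; apply: CKN. Qed.

Lemma CKX D l f n : CK D l f -> CK D l (fun x => f x ^+ n).
Proof.
move=> cf; elim: n => [|n IH]; first exact: CK_cst.
apply: (@CK_ext _ _ _ (fun x => f x * f x ^+ n)).
  by move=> x _; rewrite exprS.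
exact: CKM.
Qed.

Lemma CKV D l f : (forall x, D x -> f x != 0) -> CK D l f ->
  CK D l (fun x => (f x)^-1).
Proof.
move=> f0; elim: l => [|l IH].
  by move=> cf x Dx; apply: cvgV; [apply: f0|apply: cf].
move=> Cf; have [f' hf cf] := Cf.
exists (fun x => - f' x * ((f x)^-1 * (f x)^-1)); first exact: has_derivV.
by apply: CKM; [apply: CKN|apply: CKM; apply: IH; apply: CKS].
Qed.

Lemma CK_comp D D' l f g : (forall x, D x -> D' (g x)) ->
  CK D' l f -> CK D l g -> CK D l (fun x => f (g x)).
Proof.
move=> DD; elim: l f => [|l IH] f.
  move=> cf cg x Dx; apply: cvg_comp (cf _ (DD x Dx)).
  move=> A; rewrite /within /= => wA; have /= := cg _ Dx _ wA.
  rewrite !nbhs_simpl /= /within /=; apply: filterS => y AA Dy.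
  by apply: AA => //; apply: DD.
move=> [f' hf cf] Cg; have [g' hg cg] := Cg.
exists (fun x => f' (g x) * g' x); first exact: has_deriv_comp hf hg.
by apply: CKM => //; apply: IH => //; apply: CKS.
Qed.

(** Without isolated points, derivatives relative to D are unique. *)
Definition accum D := forall x, D x -> ProperFilter (within D x^').

Lemma accum_right D :
  (forall x, D x -> exists2 e, 0 < e & forall y, x < y < x + e -> D y) -> accum D.
Proof.
move=> h x Dx; have [e e0 he] := h x Dx.
apply: Build_ProperFilter_ex => P; rewrite /within /= /dnbhs /within /=.
rewrite /prop_near1 /= => /nbhs_ballP[d /= d0 dP].
exists (x + Num.min d e / 2).
have m0 : 0 < Num.min d e by rewrite lt_min d0.
have md : Num.min d e <= d by rewrite ge_min lexx.
have me : Num.min d e <= e by rewrite ge_min lexx orbT.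
move: (Num.min d e) m0 md me => m m0 md me.
apply: dP.
- rewrite /ball /=; have -> : x - (x + m / 2) = - (m / 2) by ring.
  by rewrite normrN gtr0_norm; lra.
- by apply/eqP => E; lra.
- by apply: he; lra.
Qed.

Lemma dnbhs_subset (x : R) (A : set R) : nbhs x A -> x^' A.
Proof. by move=> nA; apply: (@cvg_within _ (nbhs x)). Qed.

Lemma has_deriv_cvg D f g x : has_deriv D f g -> D x ->
  diff_quot f x y @[y --> within D x^'] --> g x.
Proof.
move=> h Dx; have [q [q1 q2 q3]] := h x Dx.
rewrite -q2; apply: cvg_trans (_ : q @ within D x^' --> q x); last first.
  apply: cvg_trans q3; apply: cvg_app => A wA.
  by have := dnbhs_subset (x := x) (A := [set y | D y -> A y]) wA.
apply: near_eq_cvg; apply: (filterE (F := nbhs x)) => y yx Dy.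
by rewrite /diff_quot q1 // mulfK // subr_eq0.
Qed.

Lemma cvg_has_deriv D f g :
  (forall x, D x -> diff_quot f x y @[y --> within D x^'] --> g x) ->
  has_deriv D f g.
Proof.
move=> h x Dx; exists (fun y => if y == x then g x else diff_quot f x y).
split=> [y Dy||].
- have [->|yx] := eqVneq y x; first by rewrite !subrr mulr0.
  by rewrite /diff_quot divfK // subr_eq0.
- by rewrite eqxx.
- rewrite eqxx => A Ag; have wA := h x Dx A Ag.
  have {}wA : nbhs x [set y | y != x -> D y -> A (diff_quot f x y)] by exact: wA.
  change (nbhs x [set y | D y -> A (if y == x then g x else diff_quot f x y)]).
  move: wA; apply: filterS => y /= Ay Dy; case: eqVneq => [_|yx]; last exact: Ay.
  exact: nbhs_singleton.
Qed.

Lemma has_deriv_uniq D f g g' : accum D -> has_deriv D f g ->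
  has_deriv D f g' -> forall x, D x -> g x = g' x.
Proof.
move=> aD h h' x Dx; have PF := aD x Dx.
have F1 : ProperFilter (diff_quot f x @ within D x^') by apply: fmap_proper_filter.
exact: (cvg_unique _ (has_deriv_cvg h Dx) (has_deriv_cvg h' Dx)).
Qed.

Lemma derive_inE D f g : accum D -> has_deriv D f g ->
  forall x, D x -> derive_in D f x = g x.
Proof.
move=> aD h x Dx; have PF := aD x Dx.
exact: (cvg_lim _ (has_deriv_cvg h Dx)).
Qed.

Lemma derive_in_eq D f g : (forall x, D x -> f x = g x) ->
  forall x, D x -> derive_in D f x = derive_in D g x.
Proof.
move=> fg x Dx; rewrite /derive_in.
have H f1 f2 : (forall x, D x -> f1 x = f2 x) ->
  diff_quot f1 x @ within D x^' `=>` diff_quot f2 x @ within D x^'.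
  move=> e; apply: near_eq_cvg; apply: (filterE (F := x^')) => y Dy.
  by rewrite /diff_quot !e.
by congr (lim _); apply/seteqP; split => A; apply: H => // y Dy; apply/esym/fg.
Qed.

Lemma deriven_in_eq D f g m : (forall x, D x -> f x = g x) ->
  forall x, D x -> deriven_in D m f x = deriven_in D m g x.
Proof.
move=> fg; elim: m => [|m IH] //=.
by move=> x Dx; apply: derive_in_eq.
Qed.

Lemma deriven_inS D m f : deriven_in D m.+1 f = deriven_in D m (derive_in D f).
Proof. by rewrite /deriven_in iterSr. Qed.

Lemma CK_derive D l f : accum D -> CK D l.+1 f ->
  has_deriv D f (derive_in D f) /\ CK D l (derive_in D f).
Proof.
move=> aD [g h c]; have e := derive_inE aD h; split.
  by apply: has_deriv_ext h.
exact: CK_ext c.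
Qed.

Lemma Cinf_derive D f : accum D -> Cinf D f ->
  has_deriv D f (derive_in D f) /\ Cinf D (derive_in D f).
Proof.
move=> aD h; split; first by case: (CK_derive aD (h 1%N)).
by move=> l; case: (CK_derive aD (h l.+1)).
Qed.

Lemma deriven_in_deriv D m f g : accum D -> has_deriv D f g ->
  forall x, D x -> deriven_in D m.+1 f x = deriven_in D m g x.
Proof.
move=> aD h x Dx; rewrite deriven_inS.
by apply: deriven_in_eq => // y Dy; apply: derive_inE.
Qed.

(** The derivatives chosen in [CK] are then the limits of difference quotients, by
    uniqueness. *)
Lemma Ck_inP D l f : accum D -> Ck_in D l f <-> CK D l f.
Proof.
move=> aD; elim: l f => [|l IH] f.
  split=> [[_ /subspace_continuousP]//|c].
  by split => //; apply/subspace_continuousP.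
have e m : deriven_in D m (derive_in D f) = deriven_in D m.+1 f.
  by rewrite deriven_inS.
split=> [[d c]|/(CK_derive aD)[h /IH [d c]]].
  exists (derive_in D f).
    apply: cvg_has_deriv => x Dx; exact: (d 0%N).
  by apply/IH; split => [j jl x Dx|]; rewrite e //; apply: d.
split; last by rewrite -e.
case=> [_ x Dx|j jl x Dx]; last by rewrite -e; apply: d.
by apply/cvg_ex; exists (derive_in D f x); apply: has_deriv_cvg.
Qed.

Lemma smooth_inP D f : accum D -> smooth_in D f <-> Cinf D f.
Proof. by move=> aD; split=> h l; apply/Ck_inP. Qed.

Lemma is_derive_cvg f (x a : R) : is_derive x 1 f a ->
  diff_quot f x y @[y --> x^'] --> a.
Proof.
move=> h; have /= c := @ex_derive _ _ _ _ _ _ _ h.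
have /= v := @derive_val _ _ _ _ _ _ _ h.
move/cvg_ex: c => [b c]; have vb : 'D_1 f x = b by apply: cvg_lim.
rewrite -v vb; apply/cvgrPdist_lt => e e0.
move/cvgrPdist_lt: c => /(_ e e0).
rewrite /dnbhs !near_withinE => /nbhs_ballP [d /= d0 dP].
apply/nbhs_ballP; exists d => // y; rewrite /ball /= => xy yx.
have := dP (y - x); rewrite /ball /= sub0r opprB => /(_ xy).
rewrite subr_eq0 => /(_ yx); rewrite /GRing.scale /= mulr1 subrK.
by rewrite /diff_quot mulrC.
Qed.

Lemma is_derive_has_deriv D f g :
  (forall x, D x -> is_derive x 1 f (g x)) -> has_deriv D f g.
Proof.
move=> h; apply: cvg_has_deriv => x Dx.
by apply: cvg_trans (is_derive_cvg (h x Dx)); apply: cvg_app; apply: cvg_within.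
Qed.

Lemma has_deriv_is_derive D f g x : nbhs x D -> has_deriv D f g ->
  is_derive x 1 f (g x).
Proof.
move=> nD h; have Dx := nbhs_singleton nD.
have := has_deriv_cvg h Dx.
have -> : within D x^' = x^'.
  apply/seteqP; split => A; rewrite /within /dnbhs /within /=.
    by move: nD; apply: filterS2 => y Dy Ay yx; apply: Ay.
  by apply: filterS => y Ay yx _; apply: Ay.
move=> c; suff c' : h^-1 *: (f (h *: 1 + x) - f x) @[h --> (0:R)^'] --> g x.
  by apply: DeriveDef; [apply/cvg_ex; exists (g x)|apply: cvg_lim].
apply/cvgrPdist_lt => e e0.
move/cvgrPdist_lt: c => /(_ e e0).
rewrite /dnbhs !near_withinE => /nbhs_ballP [d /= d0 dP].
apply/nbhs_ballP; exists d => // y; rewrite /ball /= sub0r normrN => xy yx.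
have := dP (y + x); rewrite /ball /= opprD addrCA subrr addr0 normrN => /(_ xy).
have yx' : y + x != x by apply: contra yx => /eqP E; apply/eqP; lra.
by move=> /(_ yx'); rewrite /diff_quot addrK /GRing.scale /= mulr1 mulrC.
Qed.
End Calculus.

(** * The closed half-line *)

Section HalfLine.
Set Implicit Arguments.
Unset Strict Implicit.
Context {R : realType}.
Implicit Types (D : set R) (f g h : R -> R) (l j : nat).

Local Notation D0 := (`[(0:R), +oo[%classic).

Lemma mem_D0 (x : R) : D0 x = (0 <= x) :> Prop.
Proof. by rewrite /= in_itv /= andbT. Qed.

Lemma accum_D0 : accum D0.
Proof.
apply: accum_right => x; rewrite mem_D0 => x0; exists 1 => // y yx.
rewrite mem_D0; lra.
Qed.

Lemma accum_co (e : R) : accum `[0, e[%classic.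
Proof.
apply: accum_right => x; rewrite /= in_itv /= => /andP[x0 xe].
by exists (e - x) => [|y yx]; rewrite ?in_itv /=; lra.
Qed.

Lemma accum_oo (e : R) : accum `]0, e[%classic.
Proof.
apply: accum_right => x; rewrite /= in_itv /= => /andP[x0 xe].
by exists (e - x) => [|y yx]; rewrite ?in_itv /=; lra.
Qed.

Lemma co_D0 (e : R) : `[0, e[%classic `<=` D0.
Proof. by move=> x; rewrite mem_D0 /= in_itv /= => /andP[]. Qed.

Lemma near_pos (x : R) : 0 < x -> \forall y \near x, 0 < y.
Proof.
move=> x0; apply/nbhs_ballP; exists x => //= y.
by rewrite /ball /= ltr_distlC; lra.
Qed.

Lemma nbhs_D0 (x : R) : 0 < x -> nbhs x D0.
Proof.
move=> /near_pos; apply: filterS => y y0; rewrite mem_D0; exact: ltW.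
Qed.

Lemma MVT_D0 f g (x : R) : has_deriv D0 f g -> 0 < x ->
  exists2 c, 0 < c < x & f x - f 0 = g c * x.
Proof.
move=> h x0.
have [|//|c] := @MVT R f g 0 x x0.
- move=> c; rewrite in_itv /= => /andP[c0 _].
  exact: (has_deriv_is_derive (nbhs_D0 c0) h).
- apply/subspace_continuousP; apply: cont_sub (has_deriv_cont h).
  by move=> y; rewrite mem_D0 /= in_itv /= => /andP[].
by rewrite in_itv /= subr0 => cx e; exists c.
Qed.

Lemma has_deriv0_cst f : has_deriv D0 f (fun=> 0) -> forall x, D0 x -> f x = f 0.
Proof.
move=> h x; rewrite mem_D0 le_eqVlt => /orP[/eqP <-//|x0].
have [c _] := MVT_D0 h x0; rewrite mul0r => /eqP; rewrite subr_eq0.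
by move/eqP.
Qed.

(** By the mean value theorem the difference quotients at the endpoint are values of
    [g] at nearby positive points, so that regularity at 0 reduces to continuity
    there. *)
Lemma has_deriv_D0 f g : cont_in D0 f -> cont_in D0 g ->
  (forall x : R, 0 < x -> is_derive x 1 f (g x)) -> has_deriv D0 f g.
Proof.
move=> cf cg h; apply: cvg_has_deriv => x; rewrite mem_D0 le_eqVlt.
move=> /orP[/eqP <-|x0]; last first.
  by apply: cvg_trans (is_derive_cvg (h x x0)); apply: cvg_app; apply: cvg_within.
apply/cvgrPdist_lt => e e0.
have D00 : D0 0 by rewrite mem_D0.
have /cvgrPdist_lt /(_ e e0) := cg 0 D00.
rewrite near_withinE => /nbhs_ballP [d /= d0 dP].
rewrite /dnbhs !near_withinE; apply/nbhs_ballP; exists d => // y /= yd yn.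
rewrite /= in_itv /= andbT le_eqVlt eq_sym (negbTE yn) /= => y0.
have [||c] := @MVT R f g 0 y y0.
- by move=> c; rewrite in_itv /= => /andP[c0 _]; apply: h.
- apply/subspace_continuousP; apply: cont_sub cf.
  by move=> z; rewrite mem_D0 /= in_itv /= => /andP[].
rewrite in_itv /= subr0 => cx E.
rewrite /diff_quot E subr0 mulfK ?gt_eqF //; apply: dP; last first.
  by rewrite /= in_itv /= andbT; lra.
move: yd; rewrite /ball /= !sub0r !normrN !gtr0_norm; lra.
Qed.

(** Extending [f] to the line by [f `|x|] makes 0 an interior point, where the
    fundamental theorem of calculus applies. *)
Lemma prim_exists f : cont_in D0 f ->
  exists A, has_deriv D0 A f /\ A 0 = 0.
Proof.
move=> cf; pose g (x : R) := f (`|x|).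
have D0m (x : R) : D0 (`|x|) by rewrite mem_D0.
have cg : continuous g.
  move=> x A fA; have := cf _ (D0m x) A fA.
  have cm : `|y| @[y --> x] --> `|x|.
    by apply: norm_continuous.
  move=> /cm H; change (nbhs x [set y | A (f `|y|)]).
  have {}H : nbhs x [set y | D0 `|y| -> A (f `|y|)] by exact: H.
  by move: H; apply: filterS => y /=; apply; apply: D0m.
(* A negative base point, so that the positive half-line and 0 are interior. *)
pose G (x : R) := \int[lebesgue_measure]_(t in `[(-1)%R, x]) g t.
have dG (x : R) : 0 <= x -> is_derive x 1 G (g x).
  move=> x0.
  have [||||dG eG] := @continuous_FTC1_closed R g (-1) x (x + 1).
  - lra.
  - apply: continuous_compact_integrable; first exact: segment_compact.
    exact: continuous_subspaceT.
  - lra.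
  - exact: cg.
  split; first exact: dG.
  by rewrite -derive1E; exact: eG.
exists (fun x => G x + - G 0); split; last by rewrite subrr.
apply: (@has_deriv_ext _ _ _ _ (fun x => G x + - G 0) (fun x => g x + 0)) => //.
  by move=> x; rewrite mem_D0 /g addr0 => x0; rewrite ger0_norm.
apply: has_derivD; last exact: has_deriv_cst.
by apply: is_derive_has_deriv => x; rewrite mem_D0; apply: dG.
Qed.
End HalfLine.

(** * Hadamard's lemma and even functions *)

Section Averages.
Set Implicit Arguments.
Unset Strict Implicit.
Context {R : realType}.
Implicit Types (D : set R) (f g h : R -> R) (l j : nat).

Local Notation D0 := (`[(0:R), +oo[%classic).

Lemma natS_neq0 j : 1 + j%:R != 0 :> R.
Proof. by rewrite addrC natr1 pnatr_eq0. Qed.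

(** The function h(x) = int_0^1 t^j f(tx) dt, which is also the integral of s^j f(s)
    over [0, x] divided by x^(j+1), characterized without division. *)
Definition is_avg j f h := cont_in D0 h /\
  has_deriv D0 (fun x => x ^+ j.+1 * h x) (fun x => x ^+ j * f x).

Lemma has_derivX D (j : nat) :
  has_deriv D (fun x : R => x ^+ j) (fun x => j%:R * x ^+ j.-1).
Proof.
elim: j => [|j IH].
  by apply: has_deriv_ext (has_deriv_cst 1) => // x _; rewrite mul0r.
apply: has_deriv_ext (has_derivM (has_deriv_id (D:=D)) IH) => x _ /=.
  by rewrite exprS.
case: j {IH} => [|j]; first by rewrite expr0 mul0r mulr0 addr0.
by rewrite /= exprS; ring.
Qed.


(** Off 0 the function is the quotient of an antiderivative; at 0, the mean value
    theorem gives h(0) - h(y) = - (c/y)^j (f(c) - f(0)) for some c in ]0, y[, whence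
    continuity. *)
Lemma is_avg_exists j f : cont_in D0 f ->
  exists2 h, is_avg j f h & h 0 = f 0 / j.+1%:R.
Proof.
move=> cf; have [|A [dA A0]] := @prim_exists R (fun x => x ^+ j * f x).
  by move=> x Dx; apply: cvgM; [exact: (CKX (l := 0) j (CK_id D0 0))|exact: cf].
pose h (x : R) : R := if x == 0 then f 0 / j.+1%:R else A x / x ^+ j.+1.
exists h; last by rewrite /h eqxx.
split.
  move=> x Dx; move: (Dx); rewrite mem_D0 le_eqVlt => /orP[/eqP x0|x0].
    rewrite -x0 {2}/h eqxx; apply/cvgrPdist_le => e e0.
    have D00 : D0 0 by rewrite mem_D0.
    have /cvgrPdist_lt /(_ e e0) := cf 0 D00.
    rewrite !near_withinE => /nbhs_ballP [d /= d0 dP].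
    apply/nbhs_ballP; exists d => // y /= yd; rewrite in_itv /= andbT le_eqVlt.
    rewrite /h eq_sym; case: eqP => [_ _|_ /= y0].
      by rewrite subrr normr0 ltW.
    pose B (x : R) := A x + - (f 0 / j.+1%:R) * x ^+ j.+1.
    have dB : has_deriv D0 B (fun x => x ^+ j * (f x - f 0)).
      apply: has_deriv_ext (has_derivD dA (has_derivM
        (has_deriv_cst (- (f 0 / j.+1%:R))) (has_derivX j.+1))) => // z _.
      by rewrite /=; field; rewrite natS_neq0.
    have [c /andP[c0 cy]] := MVT_D0 dB y0.
    rewrite /B A0 expr0n /= mulr0 addr0 subr0 => E.
    have -> : f 0 / j.+1%:R - A y / y ^+ j.+1 = - ((c / y) ^+ j * (f c - f 0)).
      have -> : A y = c ^+ j * (f c - f 0) * y + f 0 / j.+1%:R * y ^+ j.+1.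
        by rewrite -E; ring.
      rewrite expr_div_n exprS; field.
      by rewrite natS_neq0 ?expf_neq0 ?gt_eqF.
    rewrite normrN normrM -[leRHS]mul1r distrC; apply: ler_pM => //.
      rewrite ger0_norm ?exprn_ge0 ?divr_ge0 ?(ltW c0) ?(ltW y0) //.
      by rewrite exprn_ile1 ?divr_ge0 ?(ltW c0) ?(ltW y0) // ler_pdivrMr ?mul1r ?ltW.
    apply/ltW/dP; last by rewrite /= in_itv /= andbT ltW.
    move: yd; rewrite /ball /= !sub0r !normrN !gtr0_norm //; lra.
  have -> : h x = A x / x ^+ j.+1 by rewrite /h gt_eqF.
  apply: cvg_trans (_ : A y / y ^+ j.+1 @[y --> within D0 (nbhs x)] --> _); last first.
    apply: cvgM; first exact: (has_deriv_cont dA).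
    apply: cvgV; first by rewrite expf_neq0 // gt_eqF.
    exact: (CKX (l := 0) j.+1 (CK_id D0 0)).
  apply: near_eq_cvg; rewrite near_withinE.
  have := near_pos x0; apply: filterS => y y0 _.
  by rewrite /h gt_eqF.
apply: has_deriv_ext dA => // x; rewrite mem_D0 le_eqVlt /h => /orP[/eqP <-|x0].
  by rewrite eqxx expr0n /= mul0r A0.
by rewrite gt_eqF // mulrC divfK // expf_neq0 // gt_eqF.
Qed.

Lemma has_deriv_eq f g u : has_deriv D0 f u -> has_deriv D0 g u -> f 0 = g 0 ->
  forall x, D0 x -> f x = g x.
Proof.
move=> hf hg fg x Dx; apply/eqP; rewrite -subr_eq0; apply/eqP.
have h : has_deriv D0 (fun x => f x + -1 * g x) (fun=> 0).
  apply: has_deriv_ext (has_derivD hf (has_derivM (has_deriv_cst (-1)) hg)) => //.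
  by move=> y _; ring.
by have := has_deriv0_cst h Dx; rewrite fg !mulN1r subrr.
Qed.

(** Differentiation under the integral sign in int_0^1 t^j f(tx) dt; an integration by
    parts, which is [E] below, replaces the interchange of limits. *)
Lemma is_avg_deriv j f f' h h' : has_deriv D0 f f' -> is_avg j f h ->
  is_avg j.+1 f' h' -> has_deriv D0 h h'.
Proof.
move=> df [ch dh] [ch' dh'].
have E x : D0 x -> x ^+ j.+2 * h' x = x ^+ j.+1 * f x + - j.+1%:R * (x ^+ j.+1 * h x).
  move: x; apply: has_deriv_eq dh' _ _; last by rewrite !expr0n /=; ring.
  apply: has_deriv_ext (has_derivD (has_derivM (has_derivX j.+1) df)
    (has_derivM (has_deriv_cst (- j.+1%:R)) dh)) => // x _.
  by rewrite /=; ring.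
apply: has_deriv_D0 => // x x0.
pose P := `]0, +oo[%classic : set R.
have PE y : P y = (0 < y) :> Prop by rewrite /P /= in_itv /= andbT.
have PD : P `<=` D0 by move=> y; rewrite PE mem_D0 => /ltW.
apply: (@has_deriv_is_derive _ P).
  by have := near_pos x0; apply: filterS => y; rewrite PE.
have nz y : P y -> y ^+ j.+1 != 0.
  by rewrite PE => y0; rewrite expf_neq0 // gt_eqF.
have V := has_derivV nz (@has_derivX P j.+1).
apply: has_deriv_ext (has_derivM (has_deriv_sub PD dh) V) => y Py.
  by rewrite mulrAC mulfV ?mul1r // expf_neq0 // gt_eqF // -PE.
have y0 : y != 0 by rewrite gt_eqF // -PE.
apply: (mulfI (expf_neq0 j.+2 y0)); rewrite E; last exact: PD.
rewrite /= !exprS; field.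
by rewrite expf_neq0.
Qed.

Lemma is_avg_CK l j f h : CK D0 l f -> is_avg j f h -> CK D0 l h.
Proof.
elim: l j f h => [|l IH] j f h; first by move=> _ [].
move=> [f' df cf] ah; have [h' ah' _] := is_avg_exists j.+1 (CK_cont cf).
by exists h'; [exact: is_avg_deriv df ah ah'|exact: IH cf ah'].
Qed.

Lemma is_avg_deriven m j f h : Cinf D0 f -> is_avg j f h ->
  h 0 = f 0 / j.+1%:R ->
  deriven_in D0 m h 0 = deriven_in D0 m f 0 / (j + m).+1%:R.
Proof.
elim: m j f h => [|m IH] j f h cf ah h0; first by rewrite addn0.
have [df cf'] := Cinf_derive (@accum_D0 R) cf.
have [h' ah' h0'] := is_avg_exists j.+1 (CK_cont (cf' 0%N)).
have dh := is_avg_deriv df ah ah'.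
have D00 : D0 0 by rewrite mem_D0.
rewrite (deriven_in_deriv m (@accum_D0 R) dh D00).
by rewrite (IH _ _ _ cf' ah' h0') -deriven_inS addSnnS.
Qed.

(** Hadamard's lemma, with K(x) = int_0^1 f'(tx) dt: the weight t^m acquired by the
    m-th derivative of K accounts for the denominator m + 1. *)
Lemma hadamard f : Cinf D0 f -> exists K, [/\ Cinf D0 K,
  forall x, D0 x -> f x = f 0 + x * K x
  & forall m, deriven_in D0 m K 0 = deriven_in D0 m.+1 f 0 / m.+1%:R].
Proof.
move=> cf; have [df cf'] := Cinf_derive (@accum_D0 R) cf.
have [K aK K0] := is_avg_exists 0 (CK_cont (cf' 0%N)).
exists K; split.
- by move=> l; apply: is_avg_CK (cf' l) aK.
- apply: has_deriv_eq df _ _; last by rewrite mul0r addr0.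
  case: aK => _ dK.
  apply: has_deriv_ext (has_derivD (has_deriv_cst (f 0)) dK) => // x _ /=.
  by rewrite expr0 add0r mul1r.
- by move=> m; rewrite (is_avg_deriven m cf' aK K0) -deriven_inS.
Qed.

Lemma is_derive_sqrt_pos (x : R) : 0 < x -> is_derive x 1 Num.sqrt (2 * Num.sqrt x)^-1.
Proof. exact: is_derive1_sqrt. Qed.

Lemma cont_sqrt D : cont_in D Num.sqrt.
Proof. by move=> x _; apply: cvg_within_filter; apply: sqrt_continuous. Qed.

(** Whitney's theorem on even functions.  As f'(0) = 0, one has f'(x) = x K(x), and
    the derivative of f(sqrt x) is K(sqrt x) / 2; the odd derivatives of K vanish at
    0 as well, so that the argument can be repeated. *)
Lemma CK_even_sqrt l f : Cinf D0 f ->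
  (forall m, odd m -> deriven_in D0 m f 0 = 0) -> CK D0 l (fun x => f (Num.sqrt x)).
Proof.
have sD x : D0 x -> D0 (Num.sqrt x) by rewrite !mem_D0 sqrtr_ge0.
have cs g : Cinf D0 g -> cont_in D0 (fun x => g (Num.sqrt x)).
  by move=> cg; apply: (CK_comp (l := 0) sD (cg 0%N)); apply: cont_sqrt.
elim: l f => [|l IH] f cf of0; first exact: cs.
have [df cf'] := Cinf_derive (@accum_D0 R) cf.
have [K [cK KE dK]] := hadamard cf'.
have f'0 : derive_in D0 f 0 = 0 by exact: (of0 1%N).
exists (fun x => K (Num.sqrt x) / 2); last first.
  apply: CKM; last exact: CK_cst.
  by apply: IH => // m om; rewrite dK -deriven_inS of0 ?mul0r //= negbK.
apply: has_deriv_D0; first exact: cs.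
  move=> x Dx; apply: cvgM; last exact: cvg_cst.
  exact: cs.
move=> x x0.
pose P := `]0, +oo[%classic : set R.
have PE y : P y = (0 < y) :> Prop by rewrite /P /= in_itv /= andbT.
apply: (@has_deriv_is_derive _ P _ (fun x => K (Num.sqrt x) / 2)).
  by have := near_pos x0; apply: filterS => y; rewrite PE.
have ds : has_deriv P Num.sqrt (fun y : R => (2 * Num.sqrt y)^-1).
  by apply: is_derive_has_deriv => y; rewrite PE; apply: is_derive_sqrt_pos.
apply: has_deriv_ext (has_deriv_comp _ df ds) => // y; rewrite PE => y0; last first.
  by rewrite mem_D0.
rewrite KE ?mem_D0 // f'0 add0r; field.
by rewrite gt_eqF // sqrtr_gt0.
Qed.
End Averages.

(** * Antiderivatives with a logarithm *)

Section Logarithm.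
Set Implicit Arguments.
Unset Strict Implicit.
Context {R : realType}.
Implicit Types (D : set R) (f g h : R -> R) (l j : nat) (x z : R).

Local Notation D0 := (`[(0:R), +oo[%classic).
Local Notation P0 := (`](0:R), +oo[%classic).

Lemma mem_P0 (x : R) : P0 x = (0 < x) :> Prop.
Proof. by rewrite /= in_itv /= andbT. Qed.

Lemma P0_D0 : P0 `<=` D0.
Proof. by move=> x; rewrite mem_P0 mem_D0 => /ltW. Qed.

Lemma has_deriv_P0 f g :
  has_deriv P0 f g <-> (forall x, 0 < x -> is_derive x 1 f (g x)).
Proof.
split=> h; last by apply: is_derive_has_deriv => x; rewrite mem_P0; apply: h.
move=> x x0; apply: (has_deriv_is_derive _ h).
by have := near_pos x0; apply: filterS => y; rewrite mem_P0.
Qed.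

Lemma has_deriv_ln : has_deriv P0 (@ln R) (fun x => x^-1).
Proof. by apply/has_deriv_P0 => x x0; apply: is_derive1_ln. Qed.

Lemma const_P0 f : has_deriv P0 f (fun=> 0) -> forall x, 0 < x -> f x = f 1.
Proof.
move=> h.
have H (a b : R) : 0 < a -> a < b -> f a = f b.
  move=> a0 ab; have h' := (has_deriv_P0 f (fun=> 0)).1 h.
  have [||c _] := @MVT R f (fun=> 0) a b ab.
  - by move=> c; rewrite in_itv /= => ?; apply: h'; lra.
  - apply/subspace_continuousP; apply: cont_sub (has_deriv_cont h).
    by move=> y; rewrite mem_P0 /= in_itv /=; lra.
  by rewrite mul0r => /eqP; rewrite subr_eq0 => /eqP.
move=> x x0; have [x1|x1|->//] := ltgtP x 1; first exact: H.
by apply/esym/H.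
Qed.

(** Termwise integration of the Taylor expansion of [H] divided by z^(N+1): the term
    of order [N] alone produces a logarithm.  Induction on [N] peels off the
    constant term of [H]. *)
Lemma antideriv_log N (H I : R -> R) : Cinf D0 H ->
  (forall z, 0 < z -> is_derive z 1 I (H z / z ^+ N.+1)) ->
  exists P, [/\ Cinf D0 P,
    forall z, 0 < z ->
      z ^+ N * I z = P z + deriven_in D0 N H 0 / N`!%:R * (z ^+ N * ln z)
    & (0 < N)%N -> P 0 = - (H 0 / N%:R)].
Proof.
elim: N H I => [|N IH] H I cH /has_deriv_P0 dI; have [K [cK KE dK]] := hadamard cH.
  have [A [dA A0]] := prim_exists (cK 0%N).
  have d : has_deriv P0 (fun z => I z + - H 0 * ln z + -1 * A z) (fun=> 0).
    apply: has_deriv_ext (has_derivD (has_derivD dI (has_derivM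
      (has_deriv_cst (- H 0)) has_deriv_ln)) (has_derivM (has_deriv_cst (-1))
      (has_deriv_sub P0_D0 dA))) => // z z0.
    rewrite /= KE; last exact: P0_D0.
    by rewrite mem_P0 in z0; field; rewrite gt_eqF.
  have c := const_P0 d.
  exists (fun z => A z + (I 1 + - H 0 * ln 1 + -1 * A 1)); split=> //.
    move=> l; apply: CKD; last exact: CK_cst.
    by apply: CKS; exists K.
  by move=> z z0; rewrite -(c _ z0) expr0 fact0 /=; field.
pose I1 z := I z + H 0 / N.+1%:R * (z ^+ N.+1)^-1.
have [|P [cP PE P0E]] := IH K I1 cK.
  apply/has_deriv_P0.
  have nz y : P0 y -> y ^+ N.+1 != 0.
    by rewrite mem_P0 => y0; rewrite expf_neq0 // gt_eqF.
  have V := has_derivV nz (@has_derivX R P0 N.+1).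
  apply: has_deriv_ext (has_derivD dI (has_derivM
      (has_deriv_cst (H 0 / N.+1%:R)) V)) => // z z0.
  rewrite /= KE; last exact: P0_D0.
  rewrite mem_P0 in z0; rewrite !exprS; field.
  by rewrite natS_neq0 ?expf_neq0 ?gt_eqF.
exists (fun z => - (H 0 / N.+1%:R) + z * P z); split.
- by move=> l; apply: CKD; [exact: CK_cst|apply: CKM; [exact: CK_id|exact: cP]].
- move=> z z0; have := PE z z0; rewrite dK /I1 => E.
  have -> : z ^+ N.+1 * I z = z * (z ^+ N * (I z + H 0 / N.+1%:R / z ^+ N.+1))
     - H 0 / N.+1%:R.
    by rewrite !exprS; field; rewrite natS_neq0 ?expf_neq0 ?gt_eqF.
  rewrite E factS natrM exprS; field.
  by rewrite natS_neq0 pnatr_eq0 -lt0n fact_gt0.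
- by move=> _; rewrite mul0r addr0.
Qed.

Lemma factor_order k (F : R -> R) : Cinf D0 F -> taylor_order F k ->
  exists G, [/\ Cinf D0 G, forall z, D0 z -> F z = z ^+ k * G z & G 0 != 0].
Proof.
elim: k F => [|k IH] F cF [F0 Fk].
  by exists F; split=> // z _; rewrite expr0 mul1r.
have [K [cK KE dK]] := hadamard cF.
have [|G [cG GE G0]] := IH K cK.
  split=> [j jk|]; first by rewrite dK F0 // mul0r.
  by rewrite dK mulf_neq0 // invr_eq0 pnatr_eq0.
exists G; split=> // z Dz.
by rewrite KE // GE // [F 0](F0 0%N) // add0r exprS mulrA.
Qed.

(** On ]0, 1[ one has |x ln x| <= 2 sqrt x, which is ln t <= t at t = 1 / sqrt x. *)
Lemma cont_xlnx : cont_in D0 (fun x => x * ln x).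
Proof.
move=> x Dx; move: (Dx); rewrite mem_D0 le_eqVlt => /orP[/eqP <-|x0]; last first.
  apply: cvgM; first exact: cvg_within.
  apply: cvg_within_filter; exact: continuous_ln.
rewrite mul0r.
have B (y : R) : 0 < y -> y < 1 -> `|y * ln y| <= 2 * Num.sqrt y.
  move=> y0 y1; have s0 : 0 < Num.sqrt y by rewrite sqrtr_gt0.
  have l0 : ln y <= 0 by apply: ln_le0; apply: ltW.
  rewrite ler0_norm; last by rewrite mulr_ge0_le0 // ltW.
  have E : ln y = - 2 * ln ((Num.sqrt y)^-1).
    rewrite lnV ?posrE // mulrNN mulr2n mulrDl !mul1r -lnM ?posrE //.
    by rewrite -expr2 sqr_sqrtr // ltW.
  have := @le_ln1Dx R ((Num.sqrt y)^-1 - 1).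
  rewrite addrCA subrr addr0 => L.
  have {}L : ln (Num.sqrt y)^-1 <= (Num.sqrt y)^-1.
    apply: le_trans (L _) _; last by rewrite gerBl.
    by rewrite ltrBrDl subrr invr_gt0.
  have -> : - (y * ln y) = 2 * (y * ln (Num.sqrt y)^-1) by rewrite E; ring.
  rewrite ler_pM2l //; apply: le_trans (_ : y * (Num.sqrt y)^-1 <= _).
    by rewrite ler_pM2l.
  by rewrite -{1}(sqr_sqrtr (ltW y0)) expr2 mulfK // gt_eqF.
apply/cvgrPdist_le => e e0.
have D00 : D0 0 by rewrite mem_D0.
have := @cont_sqrt R D0 0 D00.
rewrite sqrtr0 => /cvgrPdist_lt /(_ (e / 2)); rewrite divr_gt0 // => /(_ isT).
rewrite !near_withinE => /nbhs_ballP [d /= d0 dP].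
apply/nbhs_ballP; exists (Num.min d 1) => /=; first by rewrite lt_min d0 ltr01.
move=> y; rewrite /ball /= !sub0r !normrN lt_min => /andP[yd y1].
rewrite in_itv /= andbT le_eqVlt => /orP[/eqP <-|y0].
  by rewrite mul0r normr0 ltW.
rewrite gtr0_norm // in y1; apply: le_trans (B y y0 y1) _.
have := dP y; rewrite /ball /= !sub0r !normrN => /(_ yd).
rewrite in_itv /= andbT (ltW y0) => /(_ isT).
rewrite ger0_norm ?sqrtr_ge0 //; lra.
Qed.

(** A derivative lowers the exponent by one and keeps the shape; the last one is a
    multiple of x ln x up to a linear term. *)
Lemma CK_powln l (al be : R) : CK D0 l (fun x => x ^+ l.+1 * (al * ln x + be)).
Proof.
have C m (a b : R) : cont_in D0 (fun x => x ^+ m.+1 * (a * ln x + b)).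
  apply: (@cont_ext _ _ _ (fun x => x ^+ m * (a * (x * ln x) + b * x))).
    by move=> x _; rewrite exprS; ring.
  apply: (CKM (l := 0)); first exact: (CKX (l := 0) m (CK_id D0 0)).
  apply: (CKD (l := 0)); apply: (CKM (l := 0)).
  - exact: (CK_cst D0 0).
  - exact: cont_xlnx.
  - exact: (CK_cst D0 0).
  - exact: (CK_id D0 0).
elim: l al be => [|l IH] al be; first exact: C.
exists (fun x => x ^+ l.+1 * (l.+2%:R * al * ln x + (l.+2%:R * be + al))) => //.
apply: has_deriv_D0 => //; apply/has_deriv_P0.
apply: has_deriv_ext (has_derivM (@has_derivX R P0 l.+2) (has_derivD (has_derivM
  (has_deriv_cst al) has_deriv_ln) (has_deriv_cst be))) => // x x0.
by rewrite mem_P0 in x0; rewrite /= !exprS; field; rewrite gt_eqF.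
Qed.

(** After [l] derivatives the function is a multiple of ln x, nonzero with [al], plus a
    constant.  The difference of its values at x and x / 2 is then a nonzero constant,
    whereas it tends to 0 by continuity at 0. *)
Lemma powln_not_CK l (e al be : R) f : 0 < e -> CK `[0, e[%classic l f ->
  (forall x, 0 < x < e -> f x = x ^+ l * (al * ln x + be)) -> al = 0.
Proof.
move=> e0; have Ie (x : R) : (`[0, e[%classic : set R) x = (0 <= x < e) :> Prop.
  by rewrite /= in_itv.
have Io (x : R) : (`]0, e[%classic : set R) x = (0 < x < e) :> Prop.
  by rewrite /= in_itv.
elim: l al be f => [|l IH] al be f.
  move=> cf fE.
  apply/eqP; apply: contraT => al0.
  have c0 : 0 < `|al * ln 2|.
    by rewrite normr_gt0 mulf_neq0 // gt_eqF // ln_gt0 // ltr1n.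
  have I0 : (`[0, e[%classic : set R) 0 by rewrite Ie lexx e0.
  have /cvgrPdist_lt /(_ (`|al * ln 2| / 2)) := cf 0 I0.
  rewrite divr_gt0 // => /(_ isT).
  rewrite !near_withinE => /nbhs_ballP [d /= d0 dP].
  pose x := Num.min d e / 2.
  have m0 : 0 < Num.min d e by rewrite lt_min d0.
  have md : Num.min d e <= d by rewrite ge_min lexx.
  have me : Num.min d e <= e by rewrite ge_min lexx orbT.
  have x0 : 0 < x by rewrite /x; lra.
  have A (y : R) : 0 < y -> y <= x -> `|f 0 - f y| < `|al * ln 2| / 2.
    move=> y0 yx; apply: dP; rewrite /ball /= ?sub0r ?normrN ?in_itv /=.
      by rewrite gtr0_norm // /x in yx *; lra.
    by rewrite /x in yx; lra.
  have A1 := A x x0 (lexx _).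
  have x2 : 0 < x / 2 by rewrite divr_gt0.
  have A2 := A (x / 2) x2.
  have {}A2 : `|f 0 - f (x / 2)| < `|al * ln 2| / 2 by apply: A2; lra.
  have E : al * ln 2 = (f 0 - f (x / 2)) - (f 0 - f x).
    rewrite (fE x) ?(fE (x / 2)); [|by rewrite /x; lra..].
    by rewrite lnM ?posrE ?invr_gt0 // lnV ?posrE // !expr0; ring.
  have := ler_normB (f 0 - f (x / 2)) (f 0 - f x); rewrite -E; lra.
case=> g dg cg fE.
suff: l.+1%:R * al = 0 by move/eqP; rewrite mulf_eq0 pnatr_eq0 /= => /eqP.
apply: (IH _ (l.+1%:R * be + al) g cg) => x xe.
have s1 : (`]0, e[%classic : set R) `<=` `[0, e[%classic.
  by move=> y; rewrite Ie Io; lra.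
have s2 : (`]0, e[%classic : set R) `<=` P0.
  by move=> y; rewrite mem_P0 Io; lra.
have dg1 := has_deriv_sub s1 dg.
have dg2 : has_deriv `]0, e[%classic f
  (fun x => x ^+ l * (l.+1%:R * al * ln x + (l.+1%:R * be + al))).
  apply: has_deriv_ext (has_deriv_sub s2 (has_derivM (@has_derivX R P0 l.+1)
    (has_derivD (has_derivM (has_deriv_cst al) has_deriv_ln) (has_deriv_cst be)))).
    by move=> y; rewrite Io; apply: fE.
  move=> y; rewrite Io => /andP[y0 _].
  by rewrite /= !exprS; field; rewrite gt_eqF.
by apply: (has_deriv_uniq (@accum_oo R e) dg1 dg2); rewrite Io.
Qed.
End Logarithm.

(** * Radial functions on the complex space *)

Section Radial.
Set Implicit Arguments.
Unset Strict Implicit.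
Context {R : realType}.

Local Notation D0 := (`[(0:R), +oo[%classic).

Lemma dotC_C n (v w : Cspace R n) : dotC v w = dotC w v.
Proof. by rewrite /dotC; congr (_ + _); apply: eq_bigr => i _; rewrite mulrC. Qed.

Lemma dotC_DZl n (h : R) (u v w : Cspace R n) :
  dotC (h *: u + v) w = h * dotC u w + dotC v w.
Proof.
rewrite /dotC mulrDr addrACA; congr (_ + _); rewrite mulr_sumr -big_split /=;
by apply: eq_bigr => i _; rewrite !mxE mulrDl mulrA.
Qed.

Lemma normsq_line n (h : R) (v p : Cspace R n) :
  normsq (h *: v + p) = normsq p + h * (2 * dotC p v + h * normsq v).
Proof.
rewrite /normsq dotC_DZl [dotC v _]dotC_C [dotC p (_ + _)]dotC_C !dotC_DZl.
by rewrite (dotC_C v p); ring.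
Qed.

Lemma normsq_e0 n (t : R) :
  normsq (t *: ((delta_mx ord0 ord0, 0) : Cspace R n.+1)) = t ^+ 2.
Proof.
rewrite /normsq /dotC /= [X in _ + X]big1 ?addr0; last first.
  by move=> i _; rewrite !mxE mulr0 mul0r.
rewrite big_ord_recl big1 ?addr0 => [|i _]; rewrite !mxE /= ?mulr1 //.
by rewrite !mulr0.
Qed.

Lemma accum_setT : accum [set: R].
Proof. by apply: accum_right => x _; exists 1. Qed.

(** Along a real line through the origin the function is F(t^2), which is smooth and
    even in t. *)
Lemma radial_Cinf n (F : R -> R) :
  smooth_map [set: Cspace R n.+1] (F \o normsq) -> Cinf D0 F.
Proof.
set e : Cspace R n.+1 := (delta_mx ord0 ord0, 0).
move=> sF.
(* The j-th derivative of the restriction to the line is the restriction of the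
   j-th directional derivative, hence differentiable. *)
pose phi j (t : R) := foldr (fun v (g : Cspace R n.+1 -> R) => 'D_v g)
  (F \o normsq) (nseq j e) (t *: e).
have dphi j : has_deriv [set: R] (phi j) (phi j.+1).
  apply: is_derive_has_deriv => t _.
  have := diff_derivable (v := e) (sF (nseq j e) (t *: e) I).
  have E : (fun h : R => h^-1 *: ((foldr (fun v (g : Cspace R n.+1 -> R) => 'D_v g)
      (F \o normsq) (nseq j e) \o shift (t *: e)) (h *: e) -
      foldr (fun v (g : Cspace R n.+1 -> R) => 'D_v g)
      (F \o normsq) (nseq j e) (t *: e))) =
     (fun h : R => h^-1 *: ((phi j \o shift t) (h *: (1 : R)) - phi j t)).
    apply/funext => h; rewrite /phi /= scalerDl.
    by rewrite /(h *: (1:R)) /= mulr1.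
  rewrite /derivable E => d; split=> //.
  by rewrite /derive -E.
have evenphi j t : phi j (- t) = (-1) ^+ j * phi j t.
  elim: j t => [|j IH] t.
    by rewrite /phi /= expr0 mul1r !normsq_e0 sqrrN.
  have d1 : has_deriv [set: R] (fun t => phi j (- t)) (fun t => phi j.+1 (- t) * (- 1)).
    have dN : has_deriv [set: R] (fun t => - t) (fun=> -1).
      apply: has_deriv_ext (has_derivM (has_deriv_cst (-1))
        (has_deriv_id (D := setT))) => // x _ /=.
        by rewrite mulN1r.
      by rewrite mul0r mulr1 add0r.
    exact: has_deriv_comp (fun _ _ => Logic.I) (dphi j) dN.
  have d2 : has_deriv [set: R] (fun t => phi j (- t)) (fun t => (-1) ^+ j * phi j.+1 t).
    apply: has_deriv_ext (has_derivM (has_deriv_cst ((-1) ^+ j)) (dphi j)) => // x _ /=.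
    by rewrite mul0r add0r.
  have := has_deriv_uniq accum_setT d1 d2 (x := t) Logic.I.
  by rewrite exprS; lra.
have dphi0 j : has_deriv D0 (phi j) (phi j.+1) by apply: has_deriv_sub (dphi j).
have cphi j : Cinf D0 (phi j).
  move=> l; elim: l j => [|l IH] j; first exact: has_deriv_cont (dphi0 j).
  by exists (phi j.+1).
have D00 : D0 0 by rewrite mem_D0.
have phiE m j : deriven_in D0 m (phi j) 0 = phi (j + m)%N 0.
  elim: m j => [|m IH] j; first by rewrite addn0.
  by rewrite (deriven_in_deriv m (@accum_D0 R) (dphi0 j) D00) IH addSnnS.
move=> l; apply: (@CK_ext _ _ _ _ (fun x => phi 0%N (Num.sqrt x))).
  by move=> x; rewrite mem_D0 => x0; rewrite /phi /= normsq_e0 sqr_sqrtr.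
apply: CK_even_sqrt => // m om; rewrite phiE.
by have := evenphi m 0; rewrite oppr0 -signr_odd om expr1 add0n; lra.
Qed.

Lemma dsq_pow n (s : R) (k : nat) (p v w : Cspace R n) : 0 < normsq p ->
  dsq ((fun z => s * Num.sqrt z ^+ k.+1) \o normsq) p v w =
  s ^+ 2 * k.+1%:R ^+ 2 * normsq p ^+ k * dsq (fun q => Num.sqrt (normsq q)) p v w.
Proof.
move=> p0; set g := fun q => Num.sqrt (normsq q).
have dg u : derivable g p u.
  apply/derivable1P.
  have -> : (fun h : R => g (h *: u + p)) =
     (fun h => Num.sqrt (normsq p + h * (2 * dotC p u + h * normsq u))).
    by apply/funext => h; rewrite /g normsq_line.
  apply/derivable1_diffP; apply: differentiable_comp.
    by apply/derivable1_diffP.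
  apply/derivable1_diffP/(@ex_derive _ _ _ _ _ _ _ (is_derive_sqrt_pos _)).
  by rewrite mul0r addr0.
have E u : 'D_u ((fun z => s * Num.sqrt z ^+ k.+1) \o normsq) p =
    s * k.+1%:R * g p ^+ k * 'D_u g p.
  have -> : (fun z => s * Num.sqrt z ^+ k.+1) \o normsq = s \*: (g ^+ k.+1).
    by apply/funext => q; rewrite /= exprfctE.
  have h := derivableP (dg u).
  have h2 := is_deriveZ s (is_deriveX k.+1 h).
  by rewrite (@derive_val _ _ _ _ _ _ _ h2) /= /GRing.scale /= !mulrA.
rewrite /dsq !E -[in normsq p ^+ k](sqr_sqrtr (ltW p0)) -exprM mulnC exprM /g.
by ring.
Qed.

Lemma cont_powR (a : R) : 0 < a -> cont_in D0 (fun x => x `^ a).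
Proof.
move=> a0 x; rewrite mem_D0 le_eqVlt => /orP[/eqP <-|x0].
  rewrite powR0 ?gt_eqF //.
  have c := powR_cvg0 a0.
  have := @cvg_at_right_within R _ (fun x => x `^ a) 0.
  rewrite powR0 ?gt_eqF // => /(_ c); apply: cvg_trans; apply: cvg_app.
  by apply: within_subset => y; rewrite mem_D0.
have c : {for x, continuous (fun x : R => x `^ a)}.
  apply: differentiable_continuous.
  by apply/derivable1_diffP/derivable_powR; rewrite in_itv /= andbT.
exact: cvg_within_filter c.
Qed.
End Radial.

(** * The profile at the origin and the radial variable *)

Section Profile.
Set Implicit Arguments.
Unset Strict Implicit.
Context {R : realType}.

Local Notation D0 := (`[(0:R), +oo[%classic).
Local Notation P0 := (`](0:R), +oo[%classic).

Lemma cont_right (f : R -> R) : cont_in D0 f -> f x @[x --> 0^'+] --> f 0.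
Proof.
move=> cf; have D00 : D0 0 by rewrite mem_D0.
apply: cvg_trans (cf 0 D00); apply: cvg_app; apply: within_subset => y /=.
by rewrite in_itv /= andbT => /ltW.
Qed.

Lemma pow_quotE k (F G : R -> R) : cont_in D0 G ->
  (forall z, 0 <= z -> F z = z ^+ k * G z) -> G 0 != 0 ->
  forall z, 0 <= z -> pow_quot k F z = (G z)^-1.
Proof.
move=> cG FE G0 z; rewrite /pow_quot; have [-> _|z0 zp] := eqVneq z 0; last first.
  by rewrite FE // invfM mulrA mulfV ?mul1r // expf_neq0.
have c : (G t)^-1 @[t --> (0:R)^'+] --> (G 0)^-1.
  by apply: cvgV => //; apply: cont_right.
suff : t ^+ k / F t @[t --> (0:R)^'+] --> (G 0)^-1 by apply: cvg_lim.
apply: cvg_trans c; apply: near_eq_cvg.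
have := nbhs_right_gt (0:R); apply: filterS => t t0.
by rewrite FE ?ltW // invfM mulrA mulfV ?mul1r // expf_neq0 // gt_eqF.
Qed.

Lemma profile_factor k (F : R -> R) : Cinf D0 F -> taylor_order F k ->
  (forall z, 0 < z -> 0 < F z) ->
  exists G, [/\ Cinf D0 G, forall z, 0 <= z -> F z = z ^+ k * G z
              & forall z, 0 <= z -> 0 < G z].
Proof.
move=> cF ok Fp; have [G [cG GE G0]] := factor_order cF ok.
have GE' z : 0 <= z -> F z = z ^+ k * G z by move=> z0; apply: GE; rewrite mem_D0.
exists G; split=> //.
have Gp z : 0 < z -> 0 < G z.
  move=> z0; have := Fp z z0; rewrite GE' ?ltW // pmulr_rgt0 //.
  exact: exprn_gt0.
move=> z; rewrite le_eqVlt => /orP[/eqP <-|]; last exact: Gp.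
rewrite lt_neqAle eq_sym G0 /=.
apply: (closed_cvg (fun y : R => 0 <= y)) (cont_right (cG 0%N)).
  exact: closed_ge.
by have := nbhs_right_gt (0:R); apply: filterS => t /Gp /ltW.
Qed.

Lemma Cinf_sqrt l : CK P0 l (@Num.sqrt R).
Proof.
elim: l => [|l IH]; first exact: cont_sqrt.
exists (fun x => (2 * Num.sqrt x)^-1).
  by apply/has_deriv_P0 => x; apply: is_derive_sqrt_pos.
apply: CKV; last by apply: CKM => //; apply: CK_cst.
by move=> x; rewrite mem_P0 => x0; rewrite mulf_neq0 // gt_eqF // sqrtr_gt0.
Qed.

(** The radial variable is a multiple of z^((k+1)/2), so that the smooth factor in its
    square is constant. *)
Lemma radial_power k (d s : R) : 0 < s ->
  radial_change k d (fun z : R => s * Num.sqrt z ^+ k.+1).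
Proof.
move=> s0.
have sub : (`]0, d[%classic : set R) `<=` P0.
  by move=> y; rewrite mem_P0 /= in_itv /= => /andP[].
split.
- apply/smooth_inP; first exact: accum_oo.
  move=> l; apply: (CK_sub sub); apply: CKM; first exact: CK_cst.
  by apply: CKX; apply: Cinf_sqrt.
- move=> z /andP[z0 _].
  have ds : has_deriv P0 (@Num.sqrt R) (fun x => (2 * Num.sqrt x)^-1).
    by apply/has_deriv_P0 => x; apply: is_derive_sqrt_pos.
  have sp x : P0 x -> P0 (Num.sqrt x) by rewrite !mem_P0 sqrtr_gt0.
  have := (has_deriv_P0 _ _).1 (has_derivM (has_deriv_cst s)
     (has_deriv_comp sp (@has_derivX R P0 k.+1) ds)) z z0.
  rewrite derive1E => h; rewrite (@derive_val _ _ _ _ _ _ _ h) /=.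
  have q0 : 0 < Num.sqrt z by rewrite sqrtr_gt0.
  rewrite mul0r add0r; apply: mulr_gt0 => //; apply: mulr_gt0.
    by apply: mulr_gt0; rewrite ?ltr0n ?exprn_gt0.
  by rewrite invr_gt0 mulr_gt0.
- have D00 : D0 0 by rewrite mem_D0.
  have c : cont_in D0 (fun z : R => s * Num.sqrt z ^+ k.+1).
    apply: (CKM (l := 0)); first exact: (CK_cst D0 0).
    exact: (CKX (l := 0) k.+1 (cont_sqrt (D := D0))).
  by have := cont_right c; rewrite sqrtr0 expr0n mulr0.
- exists (fun=> s ^+ 2); split.
  + by apply/smooth_inP; [exact: accum_co|move=> l; exact: CK_cst].
  + by move=> z _; apply: exprn_gt0.
  + move=> z /andP[z0 _].
    by rewrite exprMn -exprM mulnC exprM sqr_sqrtr ?ltW // mulrC.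
Qed.
End Profile.

(** * The coefficients of the higher order terms *)

Section Cone.
Set Implicit Arguments.
Unset Strict Implicit.
Context {R : realType} (p k : nat) (G P E : R -> R) (h : R).

Local Notation D0 := (`[(0:R), +oo[%classic).
Local Notation N := (k.+1 * p.+1)%N.
Local Notation cc := ((2 * p.+2 - 1)%:R : R).

Context (cG : Cinf D0 G) (G0 : forall z, 0 <= z -> 0 < G z) (cP : Cinf D0 P).
Context (EE : forall z, 0 <= z -> E z = P z + h * (z ^+ N * ln z)).
Context (En0 : forall z, 0 <= z -> E z != 0).
Context (E0 : E 0 = - ((G 0 ^+ p.+1)^-1 / N%:R)).

(** [E] stands for z^N (I + (2n-1) C), and [coef] for the coefficient of the metric
    divided by z^k. *)
Definition coef_regular z := k.+1%:R * G z + z * derive_in D0 G z.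
Definition coef_num z := 2 * (G z ^+ p)^-1.
Definition coef z := coef_regular z - coef_num z * (E z)^-1.
Definition cone_scale := Num.sqrt (cc * G 0 / k.+1%:R).
(** The inverse of the change of variable r = s z^((k+1)/2), with s the
    [cone_scale]. *)
Definition radial_inv (x : R) := (x / cone_scale) `^ (2 / k.+1%:R).

Definition cone_a x := coef (radial_inv x) / (k.+1%:R * cc * G 0) - 1.
Definition cone_b x :=
  (x / cone_scale) ^+ 2 * (coef (radial_inv x) - k.+1%:R * cc * G 0).
Definition cone_c x := (x / cone_scale) ^+ 2 * (G (radial_inv x) - G 0).

Lemma ccE : cc = 1 + 2 * p.+1%:R.
Proof.
have -> : (2 * p.+2 - 1 = 1 + 2 * p.+1)%N by rewrite !mulnS.
by rewrite natrD natrM.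
Qed.

Lemma cc_gt0 : 0 < cc.
Proof. by rewrite ltr0n mulnS. Qed.

(** The two terms contribute (k+1) G(0) and 2 N G(0).  The ratio of the sum
    to G(0) is the factor by which the model cone stretches the Hopf fibers. *)
Lemma coef0E : coef 0 = k.+1%:R * cc * G 0.
Proof.
rewrite /coef /coef_regular /coef_num E0 mul0r addr0 ccE natrM exprS.
have g0 := G0 (lexx 0).
field.
by rewrite ?natS_neq0 ?expf_neq0 ?gt_eqF.
Qed.

Lemma cone_scale_gt0 : 0 < cone_scale.
Proof. by rewrite sqrtr_gt0 divr_gt0 ?mulr_gt0 ?cc_gt0 ?G0. Qed.

Lemma cone_scale_sqr : cone_scale ^+ 2 = cc * G 0 / k.+1%:R.
Proof. by rewrite sqr_sqrtr // ltW // divr_gt0 ?mulr_gt0 ?cc_gt0 ?G0. Qed.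

Lemma coef0_gt0 : 0 < k.+1%:R * cc * G 0.
Proof. by rewrite !mulr_gt0 ?cc_gt0 ?G0. Qed.

Lemma radial_inv0 : radial_inv 0 = 0.
Proof. by rewrite /radial_inv mul0r powR0 // mulf_neq0 // invr_eq0. Qed.

Lemma radial_inv_ge0 x : 0 <= radial_inv x.
Proof. exact: powR_ge0. Qed.

Lemma radial_inv_D0 x : D0 x -> D0 (radial_inv x).
Proof. by rewrite !mem_D0 radial_inv_ge0. Qed.

Lemma CK_scale D l : CK D l (fun x : R => x / cone_scale).
Proof. by apply: CKM; [exact: CK_id|exact: CK_cst]. Qed.

Lemma cont_radial_inv : cont_in D0 radial_inv.
Proof.
have h0 : 0 < 2 / k.+1%:R :> R by rewrite divr_gt0.
apply: (CK_comp (l := 0) (D' := D0) (f := fun x => x `^ (2 / k.+1%:R))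
   (g := fun x => x / cone_scale)).
- by move=> x; rewrite !mem_D0 => x0; rewrite divr_ge0 // ltW // cone_scale_gt0.
- exact: cont_powR.
- exact: CK_scale.
Qed.

Lemma radial_invK z : 0 <= z -> radial_inv (cone_scale * Num.sqrt z ^+ k.+1) = z.
Proof.
move=> z0; rewrite /radial_inv mulrAC mulfV ?mul1r ?gt_eqF ?cone_scale_gt0 //.
rewrite -powR_mulrn ?sqrtr_ge0 // -powRrM mulrCA mulfV ?pnatr_eq0 // mulr1.
by rewrite powR_mulrn ?sqrtr_ge0 // sqr_sqrtr.
Qed.

Lemma CK_coef_regular l : CK D0 l coef_regular.
Proof.
apply: CKD; apply: CKM => //; [exact: CK_cst|exact: CK_id|].
exact: (Cinf_derive (@accum_D0 R) cG).2.
Qed.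

Lemma CK_coef_num l : CK D0 l coef_num.
Proof.
apply: CKM; first exact: CK_cst.
apply: CKV; last exact: CKX.
by move=> x; rewrite mem_D0 => x0; rewrite expf_neq0 // gt_eqF // G0.
Qed.

Lemma CK_coef_radial_inv l :
  CK D0 l radial_inv -> CK D0 l (fun x => E (radial_inv x)) ->
  CK D0 l (fun x => coef (radial_inv x)).
Proof.
move=> cz cE; apply: CKB.
  exact: (CK_comp radial_inv_D0 (CK_coef_regular l) cz).
apply: CKM; first exact: (CK_comp radial_inv_D0 (CK_coef_num l) cz).
by apply: CKV => // x _; apply: En0; apply: radial_inv_ge0.
Qed.

Lemma CK_coeffs l : CK D0 l radial_inv -> CK D0 l (fun x => E (radial_inv x)) ->
  [/\ CK D0 l cone_a, CK D0 l cone_b & CK D0 l cone_c].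
Proof.
move=> cz cE; have cB := CK_coef_radial_inv cz cE.
have cG' : CK D0 l (fun x => G (radial_inv x)).
  exact: (CK_comp radial_inv_D0 (cG l) cz).
split.
- by apply: CKB; [apply: CKM => //|]; exact: CK_cst.
- apply: CKM; first by apply: CKX; exact: CK_scale.
  by apply: CKB => //; exact: CK_cst.
- apply: CKM; first by apply: CKX; exact: CK_scale.
  by apply: CKB => //; exact: CK_cst.
Qed.

Lemma cont_E : cont_in D0 E.
Proof.
apply: (@cont_ext _ _ _ (fun z => P z + h * (z ^+ N * (1 * ln z + 0)))).
  by move=> z; rewrite mem_D0 mul1r addr0; apply: EE.
apply: (CKD (l := 0)); first exact: (cP 0%N).
apply: (CKM (l := 0)); first exact: (CK_cst D0 0).
exact: (CK_le (leq0n _) (CK_powln (k.+1 * p.+1).-1 1 0)).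
Qed.

Lemma cont_E_radial_inv : cont_in D0 (fun x => E (radial_inv x)).
Proof. exact: (CK_comp (l := 0) radial_inv_D0 cont_E cont_radial_inv). Qed.

Lemma coeffs_over0 l :
  CK D0 l radial_inv -> CK D0 l (fun x => E (radial_inv x)) ->
  coeffs_Ck l cone_a cone_b cone_c.
Proof.
move=> cz cE; have [ca cb cc'] := CK_coeffs cz cE.
have H f : CK D0 l f -> Ck_over0 l f.
  move=> cf; exists 1 => //; apply/Ck_inP; first exact: accum_co.
  exact: CK_sub (@co_D0 R 1) cf.
by split; apply: H.
Qed.

Lemma cone_higher_order : higher_order_coeffs cone_a cone_b cone_c.
Proof.
have cB : cont_in D0 (fun x => coef (radial_inv x)).
  exact: (CK_coef_radial_inv (l := 0) cont_radial_inv cont_E_radial_inv).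
have cG' : cont_in D0 (fun x => G (radial_inv x)).
  exact: (CK_comp (l := 0) radial_inv_D0 (cG 0) cont_radial_inv).
have [ca _ _] := CK_coeffs (l := 0) cont_radial_inv cont_E_radial_inv.
have Q (f : R -> R) : cont_in D0 f -> f 0 = 0 ->
  (x / cone_scale) ^+ 2 * f x / x ^+ 2 @[x --> (0:R)^'+] --> (0:R).
  move=> cf f0.
  have c : (cone_scale ^+ 2)^-1 * f x @[x --> (0:R)^'+] --> (0:R).
    rewrite -[X in _ --> X](mulr0 (cone_scale ^+ 2)^-1).
    apply: cvgM; first exact: cvg_cst.
    by have := cont_right cf; rewrite f0.
  apply: cvg_trans c; apply: near_eq_cvg.
  have := nbhs_right_gt (0:R); apply: filterS => x x0.
  by field; rewrite !gt_eqF // cone_scale_gt0.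
split.
- have := cont_right ca; rewrite /cone_a radial_inv0 coef0E mulfV ?subrr //.
  by rewrite gt_eqF // coef0_gt0.
- apply: Q; last by rewrite radial_inv0 coef0E subrr.
  by apply: (CKB (l := 0)) => //; exact: (CK_cst D0 0).
- apply: Q; last by rewrite radial_inv0 subrr.
  by apply: (CKB (l := 0)) => //; exact: (CK_cst D0 0).
Qed.

Lemma radial_inv_expr : (k <= 1)%N -> exists2 q, (q * k.+1 = 2)%N &
  forall x, 0 <= x -> radial_inv x = (x / cone_scale) ^+ q.
Proof.
(* 2 / (k+1) equals 2 - k for k = 0 and k = 1. *)
move=> k1; exists (2 - k)%N; first by case: k k1 => [|[|]].
move=> x x0; rewrite /radial_inv -powR_mulrn; last first.
  by rewrite divr_ge0 // ltW // cone_scale_gt0.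
congr (_ `^ _).
by case: k k1 => [|[|]] //= _; rewrite ?divr1 ?divff.
Qed.

(** In the radial variable, z^N ln z is q (x/s)^(2n-2) ln (x/s), as N q = 2n-2. *)
Lemma E_radial_inv_log : (k <= 1)%N -> exists al be,
  [/\ h = 0 -> al = 0, al = 0 -> h = 0, h = 0 -> be = 0 &
  forall x, 0 <= x ->
    E (radial_inv x) = P (radial_inv x) + x ^+ (2 * p).+2 * (al * ln x + be)].
Proof.
move=> k1; have [q qk qE] := radial_inv_expr k1; have sp := cone_scale_gt0.
have q0 : q%:R != 0 :> R by rewrite pnatr_eq0; case: q qk {qE}.
pose m := (2 * p).+2.
exists (h * q%:R / cone_scale ^+ m).
exists (- (h * q%:R * ln cone_scale / cone_scale ^+ m)); split.
- by move=> ->; rewrite !mul0r.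
- move=> /eqP; rewrite !mulf_eq0 invr_eq0 expf_eq0 (negbTE q0) (gt_eqF sp).
  by rewrite andbF !orbF => /eqP.
- by move=> ->; rewrite !mul0r oppr0.
move=> x; rewrite le_eqVlt => /orP[/eqP <-|x0].
  by rewrite EE ?radial_inv_ge0 // radial_inv0 !expr0n /= mul0r mulr0 mul0r.
rewrite EE ?radial_inv_ge0 //; congr (_ + _).
rewrite qE ?ltW // lnXn ?divr_gt0 // lnM ?posrE ?invr_gt0 // lnV ?posrE //.
rewrite -exprM mulnA qk (_ : (2 * p.+1)%N = m); last by rewrite mulnS.
rewrite -/m expr_div_n mulrnAr -mulr_natr.
by field; rewrite expf_neq0 // gt_eqF.
Qed.

Lemma CK_radial_inv l : (k <= 1)%N -> CK D0 l radial_inv.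
Proof.
move=> k1; have [q qk qE] := radial_inv_expr k1.
apply: (@CK_ext _ _ _ _ (fun x => (x / cone_scale) ^+ q)).
  by move=> x; rewrite mem_D0; apply: qE.
by apply: CKX; exact: CK_scale.
Qed.

Lemma CK_E_radial_inv l : (k <= 1)%N -> h = 0 \/ (l <= (2 * p).+1)%N ->
  CK D0 l (fun x => E (radial_inv x)).
Proof.
move=> k1 hl; have [al [be [al0 _ be0 EzE]]] := E_radial_inv_log k1.
apply: (@CK_ext _ _ _ _
  (fun x => P (radial_inv x) + x ^+ (2 * p).+2 * (al * ln x + be))).
  by move=> x; rewrite mem_D0; apply: EzE.
apply: CKD; first exact: (CK_comp radial_inv_D0 (cP l) (CK_radial_inv l k1)).
case: hl => [h0|hl]; last by apply: CK_le hl _; exact: CK_powln.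
rewrite al0 // be0 //.
apply: (@CK_ext _ _ _ _ (fun=> 0)) => [x _|]; last exact: CK_cst.
by rewrite mul0r addr0 mulr0.
Qed.

(** Solving the definition of [cone_a] for [E] expresses it rationally in terms of
    [cone_a] and of smooth functions; the regularity of [cone_a] therefore passes to
    the logarithmic term. *)
Lemma cone_a_not_CK (e : R) : (k <= 1)%N -> 0 < e ->
  CK `[0, e[%classic (2 * p).+2 cone_a -> h = 0.
Proof.
move=> k1 e0 ca; have [al [be [_ h0 _ EzE]]] := E_radial_inv_log k1; apply: h0.
set De := `[0, e[%classic in ca *; set l := (2 * p).+2 in ca EzE *.
have sub : De `<=` D0 := @co_D0 R e.
have zD x : De x -> D0 (radial_inv x) by move=> _; rewrite mem_D0 radial_inv_ge0.
have cz : CK De l radial_inv by apply: CK_sub sub _; exact: CK_radial_inv.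
have cS : CK De l (fun x => coef_regular (radial_inv x)) :=
  CK_comp zD (CK_coef_regular l) cz.
have cV : CK De l (fun x => coef_num (radial_inv x)) :=
  CK_comp zD (CK_coef_num l) cz.
have cPz : CK De l (fun x => P (radial_inv x)) := CK_comp zD (cP l) cz.
have V0 x : coef_num (radial_inv x) != 0.
  rewrite /coef_num mulf_neq0 // invr_neq0 // expf_neq0 // gt_eqF // G0 //.
  exact: radial_inv_ge0.
have Ez0 x : E (radial_inv x) != 0 by apply: En0; exact: radial_inv_ge0.
(* This quotient is [coef_regular - coef], and [coef] is affine in [cone_a]. *)
have cQ : CK De l (fun x => coef_num (radial_inv x) / E (radial_inv x)).
  apply: (@CK_ext _ _ _ _ (fun x =>
    coef_regular (radial_inv x) - (cone_a x + 1) * (k.+1%:R * cc * G 0))).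
    move=> x _; rewrite /cone_a subrK divfK ?gt_eqF ?coef0_gt0 // /coef.
    by rewrite opprB addrCA subrr addr0.
  apply: CKB => //; apply: CKM; last exact: CK_cst.
  by apply: CKD => //; exact: CK_cst.
apply: (@powln_not_CK R l e al be
  (fun x => E (radial_inv x) - P (radial_inv x)) e0).
  apply: CKB => //.
  apply: (@CK_ext _ _ _ _ (fun x =>
    coef_num (radial_inv x) / (coef_num (radial_inv x) / E (radial_inv x)))).
    by move=> x _; rewrite invf_div mulrCA divff // mulr1.
  apply: CKM => //; apply: CKV => // x _.
  by rewrite mulf_neq0 // invr_neq0.
by move=> x /andP[x0 _]; rewrite EzE ?ltW // addrC addKr.
Qed.
End Cone.

(** * The metric near the origin *)

Lemma klsc_coefE (R : realType) (p k : nat) (G E F I : R -> R) (C : R) (z : R) :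
  Cinf `[(0:R), +oo[%classic G -> (forall z, 0 <= z -> F z = z ^+ k * G z) ->
  (forall z, 0 <= z -> 0 < G z) ->
  (forall z, 0 < z ->
    E z = z ^+ (k.+1 * p.+1) * (I z + (2 * p.+2 - 1)%:R * C)) ->
  (forall z, 0 <= z -> E z != 0) ->
  0 < z -> klsc_coef p.+2 F I C z = z ^+ k * coef p k G E z.
Proof.
move=> cG FE G0 EE En0 z0.
have [dG _] := Cinf_derive (@accum_D0 R) cG.
have d : has_deriv `](0:R), +oo[%classic (fun t => t * F t)
    (fun t => t ^+ k * coef_regular k G t).
  apply: has_deriv_ext (has_deriv_sub (@P0_D0 R)
    (has_derivM (@has_derivX R _ k.+1) dG)) => t; rewrite mem_P0 => t0.
    by rewrite FE ?ltW // exprS mulrA.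
  by rewrite /coef_regular /= exprS; ring.
have d1 := (has_deriv_P0 _ _).1 d z z0.
rewrite /klsc_coef derive1E (@derive_val _ _ _ _ _ _ _ d1) /coef mulrBr.
congr (_ - _).
have Ez := En0 z (ltW z0); have Gz := G0 z (ltW z0).
have -> : I z + (2 * p.+2 - 1)%:R * C = E z / z ^+ (k.+1 * p.+1).
  by rewrite EE // mulrAC mulfV ?mul1r // expf_neq0 // gt_eqF.
rewrite /coef_num FE ?ltW //=.
have -> : (k.+1 * p.+1 = p.+1 + (k + k * p))%N by rewrite mulSn mulnS.
rewrite exprMn -exprM !exprD.
by field; rewrite Ez ?expf_neq0 ?gt_eqF.
Qed.

Theorem theorem1p8 (R : realType) (n k : nat) (F I : R -> R) (C : R)
    (hn : (2 <= n)%N)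
    (hadm : admissible n F I C)
    (hF : smooth_map [set: Cspace R n] (F \o normsq))
    (hk : taylor_order F k) :
  exists (d : R) (r a b c : R -> R),
    [/\ 0 < d, radial_change k d r & higher_order_coeffs a b c]
    /\ (forall p v w : Cspace R n, 0 < normsq p < d ->
          klsc_metric F I C p v w
          = cone_metric k r p v w + polar_tensor r a b c p v w)
    /\ ((k <= 1)%N ->
          (deriven_in `[0, +oo[ (k.+1 * n.-1) (fun z => pow_quot k F z ^+ n.-1) 0 = 0
             -> coeffs_smooth a b c)
          /\ (deriven_in `[0, +oo[ (k.+1 * n.-1) (fun z => pow_quot k F z ^+ n.-1) 0 <> 0
             -> coeffs_precisely_Ck (2 * n - 3) a b c))
    /\ ((2 <= k)%N -> coeffs_Ck 0 a b c).
Proof.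
case: n hn hadm hF => [|[|p]] // _ [_ Fp dI Ine _] hF.
have cF := radial_Cinf hF.
have [G [cG GE G0]] := profile_factor cF hk Fp.
set cc : R := (2 * p.+2 - 1)%:R in Ine *.
have cc0 : 0 < cc := cc_gt0 p.
pose D0 := `[(0:R), +oo[%classic.
have D00 : D0 0 by rewrite /D0 mem_D0.
pose N := (k.+1 * p.+1)%N.
pose H z := (G z ^+ p.+1)^-1.
have cH : Cinf D0 H.
  move=> l; apply: CKV; last exact: CKX.
  by move=> z; rewrite /D0 mem_D0 => z0; rewrite expf_neq0 // gt_eqF // G0.
have [|P [cP PE P0E]] := @antideriv_log R N H (fun z => I z + cc * C) cH.
  apply/has_deriv_P0.
  apply: has_deriv_ext (has_derivD ((has_deriv_P0 _ _).2 dI)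
    (has_deriv_cst (cc * C))) => // z; rewrite mem_P0 => z0.
  rewrite addr0 GE ?ltW // /H /N [p.+2.-1]/= mul1r exprMn -invfM; congr (_^-1).
  by rewrite -exprM [LHS]mulrC mulrA -exprD.
pose h := deriven_in D0 N H 0 / N`!%:R.
pose E z := P z + h * (z ^+ N * ln z).
have EI z : 0 < z -> E z = z ^+ N * (I z + cc * C) by move=> z0; rewrite PE.
have G0' := G0 0 (lexx 0).
have N0 : (0 < N)%N by rewrite muln_gt0.
(* The logarithmic term vanishes at 0 because N > 0. *)
have E0 : E 0 = - ((G 0 ^+ p.+1)^-1 / N%:R).
  by rewrite /E expr0n gtn_eqF // mul0r mulr0 addr0 P0E.
have En0 z : 0 <= z -> E z != 0.
  rewrite le_eqVlt => /orP[/eqP <-|z0].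
    rewrite E0 oppr_eq0 mulf_neq0 // invr_neq0 //.
      by rewrite expf_neq0 // gt_eqF.
    by rewrite pnatr_eq0 -lt0n.
  rewrite EI // mulf_neq0 //; first by rewrite expf_neq0 // gt_eqF.
  have := Ine z z0; apply: contra => /eqP e.
  have -> : 1 / cc * I z + C = (I z + cc * C) / cc.
    by field; rewrite gt_eqF.
  by rewrite e mul0r.
have HE : deriven_in D0 N (fun z => pow_quot k F z ^+ p.+1) 0 = h * N`!%:R.
  rewrite /h divfK ?pnatr_eq0 -?lt0n ?fact_gt0 //.
  apply: deriven_in_eq => // z; rewrite /D0 mem_D0 => z0.
  by rewrite (pow_quotE (cG 0%N) GE) ?gt_eqF // exprVn.
pose s := cone_scale p k G.
have s0 : 0 < s by exact: cone_scale_gt0.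
have EE z : 0 <= z -> E z = P z + h * (z ^+ N * ln z) by [].
exists 1, (fun z => s * Num.sqrt z ^+ k.+1), (cone_a p k G E), (cone_b p k G E),
  (cone_c p k G).
split; [|split; [|split]].
- split=> //; first exact: radial_power.
  exact: cone_higher_order cG G0 cP EE En0 E0.
- move=> q v w /andP[q0 _]; have q0' := ltW q0.
  rewrite /klsc_metric (@klsc_coefE R p k G E) //.
  rewrite /cone_metric /polar_tensor dsq_pow //.
  rewrite /cone_a /cone_b /cone_c radial_invK // GE //.
  set z := normsq q in q0 q0' *.
  set ds := dsq _ q v w; set hm := hopf_metric q v w; set fs := FS_metric q v w.
  set Bz := coef p k G E z.
  have ss : s ^+ 2 = cc * G 0 / k.+1%:R by exact: cone_scale_sqr.
  have -> : (s * Num.sqrt z ^+ k.+1 / cone_scale p k G) ^+ 2 = z ^+ k.+1.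
    rewrite mulrAC mulfV ?mul1r ?gt_eqF // -exprM mulnC exprM sqr_sqrtr //.
  have -> : (s * Num.sqrt z ^+ k.+1) ^+ 2 = cc * G 0 / k.+1%:R * z ^+ k.+1.
    by rewrite exprMn ss -exprM mulnC exprM sqr_sqrtr.
  rewrite ss [z ^+ k.+1]exprS -/cc.
  have K0 : k.+1%:R != 0 :> R by rewrite pnatr_eq0.
  have c0 : cc != 0 by rewrite gt_eqF.
  have g0 : G 0 != 0 by rewrite gt_eqF.
  move: (k.+1%:R : R) (cc : R) (G 0) K0 c0 g0 => K c g K0 c0 g0.
  by field; rewrite K0 c0 g0.
- move=> k1; rewrite !HE.
  have -> : (2 * p.+2 - 3 = (2 * p).+1)%N by rewrite !mulnS.
  split.
    move=> /eqP; rewrite mulf_eq0 pnatr_eq0 -[_ == 0%N]negbK -lt0n fact_gt0 orbF.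
    move=> /eqP h0.
    have H0 l : [/\ CK D0 l (cone_a p k G E), CK D0 l (cone_b p k G E)
                  & CK D0 l (cone_c p k G)].
      apply: (CK_coeffs cG G0 En0); first exact: CK_radial_inv.
      by apply: (CK_E_radial_inv G0 cP EE) => //; left.
    have Q f : Cinf D0 f -> smooth_over0 f.
      move=> cf; exists 1 => //; apply/smooth_inP; first exact: accum_co.
      by move=> l; apply: CK_sub (@co_D0 R 1) (cf l).
    by split; apply: Q => l; case: (H0 l).
  move=> h0; split.
    apply: (coeffs_over0 cG G0 En0); first exact: CK_radial_inv.
    by apply: (CK_E_radial_inv G0 cP EE) => //; right.
  case=> -[e e0 /(Ck_inP _ _ (@accum_co R e)) ca] _ _.
  apply: h0; rewrite (cone_a_not_CK cG G0 cP EE En0 k1 e0 ca).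
  by rewrite mul0r.
- move=> _; apply: (coeffs_over0 cG G0 En0); first exact: cont_radial_inv.
  exact: cont_E_radial_inv G0 cP EE.
Qed.
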